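(* Let $s>3/2$. The flow map $u_0\mapsto u(\cdot;u_0)$ associated with the Cauchy problem (P) is not uniformly continuous from $H^s(\mathbb S)$ into $C([0,T),H^s(\mathbb S))$. More precisely, there exist $T_u>0$, a constant $C>0$, and two sequences of solutions of (P) \[(u_n)_{n\in\mathbb N},\ (\widetilde u_n)_{n\in\mathbb N}\subset C([0,T_u],H^s(\mathbb S))\cap C^1([0,T_u],H^{s-1}(\mathbb S))\] such that \[\sup_{n\in\mathbb N}\max_{t\in[0,T_u]}\big(\|u_n(t)\|_{H^s}+\|\widetilde u_n(t)\|_{H^s}\big)\le C,\qquad \lim_{n\to\infty}\|u_n(0)-\widetilde u_n(0)\|_{H^s}=0,\] but \[\liminf_{n\to\infty}\|u_n(t)-\widetilde u_n(t)\|_{H^s}\ge C^{-1}|\sin t|\qquad\text{for all } t\in(0,T_u].\]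
   Context: $\mathbb S=\mathbb R/(2\pi\mathbb Z)$. For $r\in\mathbb R$, $H^r(\mathbb S)$ is the Sobolev space with norm $\|u\|_{H^r}^2=\sum_{k\in\mathbb Z}(1+k^2)^r|\langle u,\phi_k\rangle|^2$, where $\phi_k(x)=e^{ikx}/\sqrt{2\pi}$ (so $\|1\|_{H^r}=\sqrt{2\pi}$), and $\Lambda^r=(1-\partial_x^2)^{r/2}$ is the Fourier multiplier with symbol $(1+k^2)^{r/2}$. For a function $u$ set $R(u):=7u_x^2-3u^4+2u^3-10u^2-2u$. The Cauchy problem (P) is \[u_t=u_x+14uu_x+\partial_x\Lambda^{-2}R(u)\quad (t>0),\qquad u(0)=u_0,\] which is the nonlocal form of the model equation $u_t+u_x+6uu_x-6u^2u_x+12u^3u_x+u_{xxx}-u_{xxt}+14uu_{xxx}+28u_xu_{xx}=0$ for surface waves of moderate amplitude in shallow water. It is known that for $s>3/2$ and every $u_0\in H^s(\mathbb S)$, (P) has a unique maximal solution $u(\cdot;u_0)\in C([0,T),H^s)\cap C^1([0,T),H^{s-1})$, $T=T(u_0)>0$, depending continuously on $u_0$. *)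

(* Defs.v *)
From Stdlib Require Import Reals Lra ZArith ClassicalEpsilon.
Open Scope R_scope.

(** 2*pi-periodic functions on R represent functions on S = R/2piZ. *)
Definition periodic (f : R -> R) : Prop := forall x, f (x + 2 * PI) = f x.

(** Riemann integral over [a,b] (value unspecified if f is not integrable;
    it is only ever applied to continuous functions below). *)
Definition integ (f : R -> R) (a b : R) : R :=
  epsilon (inhabits 0) (fun I => exists pr : Riemann_integrable f a b, RiemannInt pr = I).

(** Real and imaginary parts (up to sign) of int_0^{2pi} f(x) e^{-ikx} dx. *)
Definition Ck (f : R -> R) (k : Z) : R := integ (fun x => f x * cos (IZR k * x)) 0 (2 * PI).
Definition Sk (f : R -> R) (k : Z) : R := integ (fun x => f x * sin (IZR k * x)) 0 (2 * PI).

(** |<f, phi_k>|^2 with phi_k = e^{ikx}/sqrt(2 pi). *)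
Definition fc2 (f : R -> R) (k : Z) : R := (Ck f k ^ 2 + Sk f k ^ 2) / (2 * PI).

Definition weight (r : R) (k : Z) : R := Rpower (1 + IZR k ^ 2) r.

(** Summation over k in Z, enumerated as k = n and k = -(n+1) for n in nat
    (all terms are nonnegative, so the order is irrelevant). *)
Definition Hterm (r : R) (f : R -> R) (n : nat) : R :=
  weight r (Z.of_nat n) * fc2 f (Z.of_nat n)
  + weight r (- Z.of_nat (S n))%Z * fc2 f (- Z.of_nat (S n))%Z.

Definition Hsq (r : R) (f : R -> R) : R :=
  epsilon (inhabits 0) (fun l => infinite_sum (Hterm r f) l).

Definition Hnorm (r : R) (f : R -> R) : R := sqrt (Hsq r f).

(** Membership in H^r(S) (only used for r > 1/2, where every element has a
    continuous representative, which we take). *)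
Definition inH (r : R) (f : R -> R) : Prop :=
  periodic f /\ continuity f /\ exists l, infinite_sum (Hterm r f) l.

(** Multiplier of d_x Lambda^{-2}: symbol i k / (1+k^2). *)
Definition mult (k : Z) : R := IZR k / (1 + IZR k ^ 2).

(** g = d_x Lambda^{-2} f, as a Fourier multiplier:
    <g,phi_k> = (i k/(1+k^2)) <f,phi_k> for all k in Z. *)
Definition is_dxLm2 (f g : R -> R) : Prop :=
  periodic g /\ continuity g /\
  forall k : Z, Ck g k = mult k * Sk f k /\ Sk g k = - (mult k * Ck f k).

(** R(u) = 7 u_x^2 - 3 u^4 + 2 u^3 - 10 u^2 - 2 u, with a = u, b = u_x. *)
Definition Rnl (a b : R) : R := 7 * b ^ 2 - 3 * a ^ 4 + 2 * a ^ 3 - 10 * a ^ 2 - 2 * a.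

Definition Hcont (r T : R) (u : R -> R -> R) : Prop :=
  forall t0, 0 <= t0 <= T -> forall eps, 0 < eps -> exists delta, 0 < delta /\
    forall t, 0 <= t <= T -> Rabs (t - t0) < delta ->
      Hnorm r (fun x => u t x - u t0 x) < eps.

Definition Hderiv (r T : R) (u v : R -> R -> R) : Prop :=
  forall t0, 0 <= t0 <= T -> forall eps, 0 < eps -> exists delta, 0 < delta /\
    forall t, 0 <= t <= T -> t <> t0 -> Rabs (t - t0) < delta ->
      Hnorm r (fun x => (u t x - u t0 x) / (t - t0) - v t0 x) < eps.

(** u in C([0,T],H^s) cap C^1([0,T],H^{s-1}) solves
    u_t = u_x + 14 u u_x + d_x Lambda^{-2} R(u) on [0,T].
    (ux is the classical x-derivative, which exists since H^s embeds in C^1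
    for s > 3/2; v = u_t; g = d_x Lambda^{-2} R(u).) *)
Definition is_solution (s T : R) (u : R -> R -> R) : Prop :=
  exists ux v g : R -> R -> R,
    (forall t, 0 <= t <= T ->
       inH s (u t) /\
       (forall x, derivable_pt_lim (u t) x (ux t x)) /\
       inH (s - 1) (v t) /\
       is_dxLm2 (fun x => Rnl (u t x) (ux t x)) (g t) /\
       (forall x, v t x = ux t x + 14 * u t x * ux t x + g t x)) /\
    Hcont s T u /\ Hcont (s - 1) T v /\ Hderiv (s - 1) T u v.

(* Main.v *)
(** The two sequences are [u = m + N^(-s) * w(t, N * (x + c * t))] with [c = 1 + 14 * m], [N]
    large, and [m = 1 / (7 * N)] respectively [m = 0]. For this ansatz the equation of [w] reads
    [w_t = 14 e N w w_y + (multiplier) (e N w_y^2, w / N, ...)] with [e = N^(-s)]: since [s > 1],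
    all coefficients tend to [0] and only first derivatives occur, so the Cauchy-Kovalevskaya
    series [w = sum_j t^j w_j(y)] with [w_0 = cos y] converges on [0, 1] uniformly in [N], and [w]
    stays [O(max (e N, 1 / N))]-close to [cos y]. The [w_j] are trigonometric polynomials of
    degree at most [3 j + 1]; thus one derivative costs a factor [O(j)], which is compensated by
    the factor [1 / (j + 1)] of the time integration, and every Sobolev norm is controlled by the
    l^1 norms of the coefficients of the [w_j]. The two solutions differ by [m -> 0] at [t = 0],
    but their speeds differ by [14 * m = 2 / N], hence the phases of their leading terms
    [N^(-s) * cos (N * (x + c * t))] differ by [2 * t]. *)

From Coquelicot Require Import Coquelicot.
From Stdlib Require Import Lra Lia ZArith List ClassicalEpsilon FunctionalExtensionality.
Require Import Defs.
From Stdlib Require Import Reals.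
Import ListNotations.
Open Scope R_scope.

(** * Fourier coefficients *)

(** The waves are exact solutions, so neither energy estimates nor continuous dependence on the data
    enter; only their distance to a cosine is estimated. The amplitude [N^(-s)] keeps the H^s norm
    of a wave of frequency [N] bounded. The speed [c] absorbs the transport by the mean value, so
    that [m] survives only in the nonlocal term, where the constant [Rnl m 0] is annihilated by
    [d_x Lambda^{-2}]. In that term [w_y^2] is the obstacle: it is harmless because the multiplier
    gains [1 / N] together with one derivative, provided that the norm of [w_j] includes the norm of
    its derivative. The norms are summed with the weights [2^j], that is at [t = 2]. On [0, 1] this
    leaves a geometric factor, which absorbs every polynomial in [j] coming from Sobolev weights or
    time derivatives, so H^r bounds reduce to sup norms and degrees. The separation is read off the
    single Fourier coefficient at frequency [N]: there the weight [N^s] cancels the amplitude, and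
    the error relative to the amplitude tends to 0. *)

Lemma integ_RInt (f : R -> R) (a b : R) : ex_RInt f a b -> integ f a b = RInt f a b.
Proof.
  intros H. unfold integ.
  destruct (epsilon_spec (inhabits 0)
    (fun I => exists pr : Riemann_integrable f a b, RiemannInt pr = I)) as [pr Hpr].
  - exists (RiemannInt (ex_RInt_Reals_0 f a b H)), (ex_RInt_Reals_0 f a b H); reflexivity.
  - rewrite <- Hpr. symmetry. apply RInt_Reals.
Qed.

Lemma continuity_continuous (f : R -> R) : continuity f -> forall x, continuous f x.
Proof. intros H x. apply continuity_pt_filterlim, H. Qed.

(** [Ck f k] and [Sk f k] are the values at [th = 0] and [th = - PI / 2]. *)
Definition fcoef (f : R -> R) (k : Z) (th : R) : R :=
  integ (fun x => f x * cos (IZR k * x + th)) 0 (2 * PI).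

Lemma Ck_fcoef (f : R -> R) (k : Z) : Ck f k = fcoef f k 0.
Proof.
  unfold Ck, fcoef. f_equal. apply functional_extensionality; intros x.
  now rewrite Rplus_0_r.
Qed.

Lemma Sk_fcoef (f : R -> R) (k : Z) : Sk f k = fcoef f k (- (PI / 2)).
Proof.
  unfold Sk, fcoef. f_equal. apply functional_extensionality; intros x.
  rewrite <- (cos_neg (IZR k * x + _)), <- cos_shift. do 2 f_equal. ring.
Qed.

Lemma continuity_cos_affine (a b : R) : continuity (fun x => cos (a * x + b)).
Proof.
  apply (continuity_comp (fun x => a * x + b) cos).
  - intros x. apply derivable_continuous_pt. exists a. apply is_derive_Reals. auto_derive; auto. ring.
  - apply continuity_cos.
Qed.

Lemma is_RInt_fcoef (f : R -> R) (k : Z) (th : R) : continuity f ->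
  is_RInt (fun x => f x * cos (IZR k * x + th)) 0 (2 * PI) (fcoef f k th).
Proof.
  intros Hf.
  assert (E : ex_RInt (fun x => f x * cos (IZR k * x + th)) 0 (2 * PI)).
  { apply (ex_RInt_continuous (V := R_CompleteNormedModule)). intros z _.
    apply continuity_continuous.
    apply (continuity_mult f); [exact Hf | apply continuity_cos_affine]. }
  unfold fcoef. rewrite (integ_RInt _ _ _ E). apply (RInt_correct _ _ _ E).
Qed.

Lemma is_RInt_fcoef_eq (f : R -> R) (k : Z) (th l : R) :
  is_RInt (fun x => f x * cos (IZR k * x + th)) 0 (2 * PI) l -> fcoef f k th = l.
Proof.
  intros H. unfold fcoef. rewrite integ_RInt by (exists l; exact H).
  apply is_RInt_unique, H.
Qed.

Lemma fcoef_lin (a b : R) (f g : R -> R) (k : Z) (th : R) : continuity f -> continuity g ->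
  fcoef (fun x => a * f x + b * g x) k th = a * fcoef f k th + b * fcoef g k th.
Proof.
  intros Hf Hg. apply is_RInt_fcoef_eq.
  apply (is_RInt_ext (fun x => plus (scal a (f x * cos (IZR k * x + th)))
                                    (scal b (g x * cos (IZR k * x + th))))).
  { intros x _. unfold plus, scal; simpl; unfold Hierarchy.mult; simpl. ring. }
  apply (is_RInt_plus (V := R_NormedModule));
    apply (is_RInt_scal (V := R_NormedModule)); apply is_RInt_fcoef; assumption.
Qed.

Lemma fcoef_bound (f : R -> R) (k : Z) (th M : R) : continuity f ->
  (forall x, Rabs (f x) <= M) -> Rabs (fcoef f k th) <= 2 * PI * M.
Proof.
  intros Hf HM.
  replace (2 * PI * M) with ((2 * PI - 0) * M) by ring.
  apply (norm_RInt_le_const (V := R_NormedModule)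
           (fun x => f x * cos (IZR k * x + th)) 0 (2 * PI)).
  - pose proof PI_RGT_0. lra.
  - intros x _. change (Rabs (f x * cos (IZR k * x + th)) <= M). rewrite Rabs_mult.
    pose proof (HM x). pose proof (Rabs_pos (f x)).
    assert (Rabs (cos (IZR k * x + th)) <= 1) by (apply Rabs_le, COS_bound).
    pose proof (Rabs_pos (cos (IZR k * x + th))). nra.
  - apply is_RInt_fcoef, Hf.
Qed.

Lemma cos_sin_period_Z (x : R) (k : Z) :
  cos (x + 2 * IZR k * PI) = cos x /\ sin (x + 2 * IZR k * PI) = sin x.
Proof.
  destruct (Z_le_gt_dec 0 k) as [H|H].
  - rewrite <- (Z2Nat.id k H), <- INR_IZR_INZ. split; [apply cos_period|apply sin_period].
  - rewrite <- (cos_period (x + 2 * IZR k * PI) (Z.to_nat (- k))),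
      <- (sin_period (x + 2 * IZR k * PI) (Z.to_nat (- k))).
    rewrite INR_IZR_INZ, Z2Nat.id by lia. rewrite opp_IZR.
    split; f_equal; ring.
Qed.

Lemma is_RInt_cos_affine (q : Z) (th : R) :
  is_RInt (fun x => cos (IZR q * x + th)) 0 (2 * PI)
    (if Z.eq_dec q 0 then 2 * PI * cos th else 0).
Proof.
  destruct (Z.eq_dec q 0) as [->|Hq].
  - apply (is_RInt_ext (fun _ => cos th)).
    { intros x _. f_equal. ring. }
    replace (2 * PI * cos th) with (scal (2 * PI - 0) (cos th))
      by (unfold scal; simpl; unfold Hierarchy.mult; simpl; ring).
    apply (is_RInt_const (V := R_NormedModule)).
  - assert (Hq' : IZR q <> 0) by (apply not_0_IZR; exact Hq).
    replace 0 with (minus (sin (IZR q * (2 * PI) + th) / IZR q) (sin (IZR q * 0 + th) / IZR q)) at 2.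
    + apply (is_RInt_derive (V := R_CompleteNormedModule) (fun x => sin (IZR q * x + th) / IZR q)).
      * intros x _. auto_derive; auto. field. exact Hq'.
      * intros x _. apply continuity_continuous, continuity_cos_affine.
    + unfold minus, plus, opp; simpl.
      replace (IZR q * (2 * PI) + th) with (IZR q * 0 + th + 2 * IZR q * PI) by ring.
      rewrite (proj2 (cos_sin_period_Z _ q)). ring.
Qed.

Lemma fcoef_cos (l k : Z) (phi th : R) :
  fcoef (fun x => cos (IZR l * x + phi)) k th =
  (if Z.eq_dec (l + k) 0 then PI * cos (phi + th) else 0) +
  (if Z.eq_dec (l - k) 0 then PI * cos (phi - th) else 0).
Proof.
  apply is_RInt_fcoef_eq.
  apply (is_RInt_ext (fun x => plus (scal (/ 2) (cos (IZR (l + k) * x + (phi + th))))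
                                    (scal (/ 2) (cos (IZR (l - k) * x + (phi - th)))))).
  { intros x _. unfold plus, scal; simpl; unfold Hierarchy.mult; simpl.
    rewrite plus_IZR, minus_IZR.
    replace ((IZR l + IZR k) * x + (phi + th)) with ((IZR l * x + phi) + (IZR k * x + th)) by ring.
    replace ((IZR l - IZR k) * x + (phi - th)) with ((IZR l * x + phi) - (IZR k * x + th)) by ring.
    rewrite cos_plus, cos_minus. field. }
  replace ((if Z.eq_dec (l + k) 0 then PI * cos (phi + th) else 0) +
           (if Z.eq_dec (l - k) 0 then PI * cos (phi - th) else 0)) with
    (plus (scal (/ 2) (if Z.eq_dec (l + k) 0 then 2 * PI * cos (phi + th) else 0))
          (scal (/ 2) (if Z.eq_dec (l - k) 0 then 2 * PI * cos (phi - th) else 0))).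
  - apply (is_RInt_plus (V := R_NormedModule));
      apply (is_RInt_scal (V := R_NormedModule)); apply is_RInt_cos_affine.
  - unfold plus, scal; simpl; unfold Hierarchy.mult; simpl.
    destruct (Z.eq_dec (l + k) 0); destruct (Z.eq_dec (l - k) 0); field.
Qed.

(** * Normally convergent series of functions *)

Lemma ex_series_abs_le (a b : nat -> R) :
  (forall n, Rabs (a n) <= b n) -> ex_series b -> ex_series a.
Proof. apply (ex_series_le (V := R_CompleteNormedModule)). Qed.

Lemma Series_abs_le (a b : nat -> R) :
  (forall n, Rabs (a n) <= b n) -> ex_series b -> Rabs (Series a) <= Series b.
Proof.
  intros H Hb. eapply Rle_trans; [apply Series_Rabs|].
  - apply (ex_series_abs_le _ b); auto. intros n. now rewrite Rabs_Rabsolu.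
  - apply Series_le; auto. intros n. split; [apply Rabs_pos|apply H].
Qed.

Lemma Series_continuity (f : nat -> R -> R) (M : nat -> R) :
  (forall j, continuity (f j)) -> (forall j x, Rabs (f j x) <= M j) -> ex_series M ->
  continuity (fun x => Series (fun j => f j x)).
Proof.
  intros Hc HM HS.
  assert (E : forall x, ex_series (fun j => f j x)).
  { intros x. apply (ex_series_abs_le _ M); auto. }
  assert (cv : forall x, {l : R | Un_cv (fun N => SP f N x) l}).
  { intros x. exists (Series (fun j => f j x)).
    apply (proj1 (is_series_Reals _ _)), Series_correct, E. }
  assert (H : forall x, SFL f cv x = Series (fun j => f j x)).
  { intros x. unfold SFL. destruct (cv x) as [l Hl]. symmetry.
    apply is_series_unique, is_series_Reals, Hl. }
  replace (fun x => Series (fun j => f j x)) with (SFL f cv)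
    by (apply functional_extensionality; exact H).
  apply SFL_continuity; auto. intros r. exists M, (Series M). split.
  - replace (fun n => sum_f_R0 (fun k => Rabs (M k)) n) with (fun n => sum_f_R0 M n).
    + apply (proj1 (is_series_Reals _ _)), Series_correct, HS.
    + apply functional_extensionality; intros n. apply sum_eq. intros i _.
      symmetry. apply Rabs_pos_eq. eapply Rle_trans; [apply Rabs_pos | apply (HM i 0)].
  - intros n y _. apply HM.
Qed.

(** Partial sums differ from the sum uniformly by a tail of [M], and by [fcoef_bound] a Fourier
    coefficient is continuous for the sup norm. *)
Lemma fcoef_Series (f : nat -> R -> R) (M : nat -> R) (k : Z) (th : R) :
  (forall j, continuity (f j)) -> (forall j x, Rabs (f j x) <= M j) -> ex_series M ->
  is_series (fun j => fcoef (f j) k th) (fcoef (fun x => Series (fun j => f j x)) k th).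
Proof.
  intros Hc HM HS.
  pose proof (Series_continuity f M Hc HM HS) as HC.
  set (F := fun x => Series (fun j => f j x)) in *.
  assert (Hpart : forall n, continuity (fun x => sum_f_R0 (fun j => f j x) n)).
  { induction n; simpl; auto. apply (continuity_plus _ (f (S n))); auto. }
  assert (Hfp : forall n, fcoef (fun x => sum_f_R0 (fun j => f j x) n) k th =
                  sum_f_R0 (fun j => fcoef (f j) k th) n).
  { induction n; simpl; auto. rewrite <- IHn.
    rewrite <- (Rmult_1_l (fcoef (fun x => sum_f_R0 _ n) k th)),
      <- (Rmult_1_l (fcoef (f (S n)) k th)), <- fcoef_lin; auto.
    f_equal. apply functional_extensionality; intros x. ring. }
  apply is_series_Reals. intros eps Heps.
  pose proof PI_RGT_0 as HPI.
  assert (He : 0 < eps / (4 * PI)) by (apply Rdiv_lt_0_compat; lra).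
  destruct (proj1 (is_series_Reals _ _) (Series_correct M HS) _ He) as [N HN].
  exists N. intros n Hn. unfold Rdist. rewrite <- Hfp.
  replace (fcoef (fun x => sum_f_R0 (fun j => f j x) n) k th - fcoef F k th) with
    (fcoef (fun x => 1 * sum_f_R0 (fun j => f j x) n + (-1) * F x) k th)
    by (rewrite fcoef_lin by auto; ring).
  apply Rle_lt_trans with (2 * PI * (eps / (4 * PI))).
  - apply fcoef_bound.
    + apply (continuity_plus (fun x => 1 * _) (fun x => -1 * F x)).
      * apply (continuity_scal (fun x => sum_f_R0 _ n)), Hpart.
      * apply (continuity_scal F), HC.
    + intros x. left.
      specialize (HN n Hn). unfold Rdist in HN.
      assert (ES : ex_series (fun j => f j x)) by (apply (ex_series_abs_le _ M); auto).
      assert (A : F x = sum_f_R0 (fun j => f j x) n + Series (fun j => f (S n + j)%nat x)).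
      { unfold F. rewrite (Series_incr_n _ (S n)); auto with arith. }
      assert (B : Series M = sum_f_R0 M n + Series (fun j => M (S n + j)%nat)).
      { rewrite (Series_incr_n _ (S n)); auto with arith. }
      assert (D : Rabs (Series (fun j => f (S n + j)%nat x)) <= Series (fun j => M (S n + j)%nat)).
      { apply Series_abs_le; [intros j; apply HM|]. now apply (ex_series_incr_n M (S n)). }
      replace (1 * sum_f_R0 (fun j => f j x) n + -1 * F x) with
        (- Series (fun j => f (S n + j)%nat x)) by (rewrite A; ring).
      rewrite Rabs_Ropp. eapply Rle_lt_trans; [exact D|].
      rewrite B in HN.
      replace (sum_f_R0 M n - _) with (- Series (fun j => M (S n + j)%nat)) in HN by ring.
      rewrite Rabs_Ropp in HN. eapply Rle_lt_trans; [apply Rle_abs|exact HN].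
  - replace (2 * PI * (eps / (4 * PI))) with (eps / 2) by (field; lra). lra.
Qed.

(** * Sobolev norms of normally convergent series *)

Lemma fc2_nonneg (f : R -> R) (k : Z) : 0 <= fc2 f k.
Proof.
  unfold fc2. apply Rmult_le_pos; [nra|]. left; apply Rinv_0_lt_compat. pose proof PI_RGT_0; lra.
Qed.

Lemma weight_pos (r : R) (k : Z) : 0 < weight r k.
Proof. apply exp_pos. Qed.

Lemma Hterm_nonneg (r : R) (f : R -> R) (n : nat) : 0 <= Hterm r f n.
Proof.
  apply Rplus_le_le_0_compat; apply Rmult_le_pos;
    first [left; apply weight_pos | apply fc2_nonneg].
Qed.

Lemma Hsq_eq (r : R) (f : R -> R) (l : R) : infinite_sum (Hterm r f) l -> Hsq r f = l.
Proof.
  intros H. apply (uniqueness_sum (Hterm r f)); [|exact H].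
  apply (epsilon_spec (inhabits 0) (fun l => infinite_sum (Hterm r f) l)). now exists l.
Qed.

(** [Hsq] is chosen by [epsilon], so a bound on it says something only together with convergence.
    For this reason the estimates below deliver the sum and its bound at once. *)
Lemma infinite_sum_bounded (a : nat -> R) (B : R) :
  (forall n, 0 <= a n) -> (forall n, sum_f_R0 a n <= B) ->
  exists l, infinite_sum a l /\ 0 <= l <= B.
Proof.
  intros Ha HB.
  destruct (growing_cv (sum_f_R0 a)) as [l Hl].
  - intros n. simpl. specialize (Ha (S n)). lra.
  - exists B. intros x [n ->]. apply HB.
  - exists l. split; [exact Hl|]. split.
    + apply Rle_trans with (sum_f_R0 a 0); [apply Ha|].
      apply (growing_ineq (sum_f_R0 a)); [|exact Hl].
      intros n. simpl. specialize (Ha (S n)). lra.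
    + apply Rnot_lt_le; intros Hlt.
      destruct (Hl (l - B)) as [n0 Hn0]; [lra|].
      specialize (Hn0 n0 (le_n _)). specialize (HB n0). unfold Rdist in Hn0.
      apply Rabs_def2 in Hn0. lra.
Qed.

(** Telescoping: [(x + 1) * (x + 2) / 2 <= 1 + (x + 1) ^ 2], and the reciprocal of the left side is
    [2 / (x + 1) - 2 / (x + 2)]. The 3 makes the case [n = 0] an equality. *)
Lemma sum_inv_sq_le (n : nat) :
  sum_f_R0 (fun k => / (1 + INR k ^ 2)) n <= 3 - 2 / (INR n + 1).
Proof.
  induction n as [|n IH]; [simpl; lra|].
  rewrite tech5, S_INR. pose proof (pos_INR n) as Hn. set (x := INR n) in *.
  assert (/ (1 + (x + 1) ^ 2) <= 2 / (x + 1) - 2 / (x + 1 + 1)); [|lra].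
  replace (2 / (x + 1) - 2 / (x + 1 + 1)) with (/ ((x + 1) * (x + 2) / 2)) by (field; lra).
  apply Rinv_le_contravar; nra.
Qed.

(** Up to [n] only the [n / N + 1] multiples of [N] contribute, so the sum is one over the
    quotients. The bound does not depend on [N], which the later uniformity in the frequency
    requires. *)
Lemma sum_multiples_le (h : nat -> R) (N : nat) (B : R) : (0 < N)%nat -> 0 <= B ->
  (forall n, (n mod N <> 0)%nat -> h n = 0) ->
  (forall k, h (N * k)%nat <= B / (1 + INR k ^ 2)) ->
  forall n, sum_f_R0 h n <= 3 * B.
Proof.
  intros HN HB Hz Hk n.
  assert (A : sum_f_R0 h n <= sum_f_R0 (fun k => / (1 + INR k ^ 2) * B) (n / N)).
  { induction n as [|n IH].
    - rewrite Nat.Div0.div_0_l. simpl. specialize (Hk 0%nat). rewrite Nat.mul_0_r in Hk.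
      simpl in Hk. lra.
    - rewrite tech5. destruct (Nat.eq_dec (S n mod N) 0) as [H0|H0].
      + apply Nat.Div0.mod_divides in H0. destruct H0 as [q Hq].
        destruct q as [|q]; [lia|].
        replace (S n / N)%nat with (S q) by (rewrite Hq, Nat.mul_comm, Nat.div_mul; lia).
        replace (n / N)%nat with q in IH.
        2:{ apply (Nat.div_unique n N q (N - 1)); lia. }
        rewrite tech5, Hq. specialize (Hk (S q)). lra.
      + rewrite (Hz _ H0), Rplus_0_r.
        replace (S n / N)%nat with (n / N)%nat; [exact IH|].
        pose proof (Nat.div_mod_eq (S n) N). pose proof (Nat.mod_upper_bound (S n) N).
        symmetry. apply (Nat.div_unique n N _ (S n mod N - 1)); lia. }
  eapply Rle_trans; [exact A|].
  rewrite <- scal_sum, Rmult_comm. apply Rmult_le_compat_r; [exact HB|].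
  eapply Rle_trans; [apply sum_inv_sq_le|].
  assert (0 < 2 / (INR (n / N) + 1)); [|lra].
  apply Rdiv_lt_0_compat; [lra|]. pose proof (pos_INR (n / N)). lra.
Qed.

Lemma Hsum_lacunary (N : nat) (r B : R) (f : R -> R) : (0 < N)%nat -> 0 <= B ->
  (forall k, ~ (exists k', k = (Z.of_nat N * k')%Z) -> fc2 f k = 0) ->
  (forall k, weight r (Z.of_nat N * k) * fc2 f (Z.of_nat N * k) <= B / (1 + IZR k ^ 2)) ->
  exists l, infinite_sum (Hterm r f) l /\ 0 <= l <= 6 * B.
Proof.
  intros HN HB Hz Hk.
  assert (A : forall e, (e = 1 \/ e = -1)%Z -> forall n,
    sum_f_R0 (fun n => weight r (e * Z.of_nat n) * fc2 f (e * Z.of_nat n)) n <= 3 * B).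
  { intros e He. apply (sum_multiples_le _ N); auto.
    - intros n Hn. rewrite Hz; [ring|]. intros [k' Hk']. apply Hn.
      apply Nat.Div0.mod_divides. exists (Z.abs_nat k'). nia.
    - intros k. specialize (Hk (e * Z.of_nat k)%Z).
      replace (e * Z.of_nat (N * k))%Z with (Z.of_nat N * (e * Z.of_nat k))%Z by lia.
      replace (INR k ^ 2) with (IZR (e * Z.of_nat k) ^ 2); [exact Hk|].
      rewrite mult_IZR, <- INR_IZR_INZ. destruct He as [-> | ->]; ring. }
  apply infinite_sum_bounded; [apply Hterm_nonneg|].
  intros n. unfold Hterm. rewrite sum_plus.
  pose proof (A 1%Z (or_introl eq_refl) n) as A1.
  (* The negative frequencies in [Hterm] start at -1, so this sum is taken one index further and its
     nonnegative term at 0 is discarded. *)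
  pose proof (A (-1)%Z (or_intror eq_refl) (S n)) as A2.
  rewrite decomp_sum in A2 by lia. simpl pred in A2.
  assert (E : forall g h : nat -> R, (forall i, g i = h i) -> sum_f_R0 g n = sum_f_R0 h n).
  { intros g h Hgh. apply sum_eq. auto. }
  rewrite (E _ (fun n => weight r (1 * Z.of_nat n) * fc2 f (1 * Z.of_nat n)))
    by (intros i; now rewrite Z.mul_1_l).
  rewrite (E (fun l => weight r (- Z.of_nat (S l)) * _)
             (fun i => weight r (-1 * Z.of_nat (S i)) * fc2 f (-1 * Z.of_nat (S i))))
    by (intros i; do 2 f_equal; lia).
  assert (0 <= weight r (-1 * Z.of_nat 0) * fc2 f (-1 * Z.of_nat 0)).
  { apply Rmult_le_pos; [left; apply weight_pos|apply fc2_nonneg]. }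
  lra.
Qed.

Lemma fc2_lin_le (a b : R) (f g : R -> R) (k : Z) : continuity f -> continuity g ->
  fc2 (fun x => a * f x + b * g x) k <= 2 * a ^ 2 * fc2 f k + 2 * b ^ 2 * fc2 g k.
Proof.
  intros Hf Hg. unfold fc2. rewrite !Ck_fcoef, !Sk_fcoef, !fcoef_lin by auto.
  pose proof PI_RGT_0.
  set (c1 := fcoef f k 0). set (c2 := fcoef g k 0).
  set (s1 := fcoef f k _). set (s2 := fcoef g k _).
  apply Rmult_le_reg_r with (2 * PI); [lra|]. field_simplify; [|lra|lra].
  pose proof (pow2_ge_0 (a * c1 - b * c2)). pose proof (pow2_ge_0 (a * s1 - b * s2)). nra.
Qed.

Lemma Hsum_lin (r a b l1 l2 : R) (f g : R -> R) : continuity f -> continuity g ->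
  infinite_sum (Hterm r f) l1 -> infinite_sum (Hterm r g) l2 ->
  exists l, infinite_sum (Hterm r (fun x => a * f x + b * g x)) l /\
    0 <= l <= 2 * a ^ 2 * l1 + 2 * b ^ 2 * l2.
Proof.
  intros Hf Hg H1 H2.
  apply infinite_sum_bounded; [apply Hterm_nonneg|]. intros n.
  apply Rle_trans with
    (sum_f_R0 (fun n => Hterm r f n * (2 * a ^ 2) + Hterm r g n * (2 * b ^ 2)) n).
  - apply sum_Rle. intros i _. unfold Hterm.
    pose proof (fc2_lin_le a b f g (Z.of_nat i) Hf Hg).
    pose proof (fc2_lin_le a b f g (- Z.of_nat (S i)) Hf Hg).
    pose proof (weight_pos r (Z.of_nat i)). pose proof (weight_pos r (- Z.of_nat (S i))).
    nra.
  - rewrite sum_plus, <- !scal_sum.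
    assert (G : forall h l, infinite_sum (Hterm r h) l -> sum_f_R0 (Hterm r h) n <= l).
    { intros h l Hl. apply (growing_ineq (sum_f_R0 (Hterm r h))); [|exact Hl].
      intros m. simpl. pose proof (Hterm_nonneg r h (S m)). lra. }
    pose proof (G f l1 H1). pose proof (G g l2 H2).
    pose proof (pow2_ge_0 a). pose proof (pow2_ge_0 b). nra.
Qed.

Lemma ex_series_poly_geom (q : nat) : ex_series (fun j => (INR j + 1) ^ q * (1 / 2) ^ j).
Proof.
  apply (ex_series_abs_le _ (fun j => Rabs ((INR j + 1) ^ q * (1 / 2) ^ j)));
    [intros; apply Rle_refl|].
  assert (P : forall j, 0 < INR j + 1) by (intros j; pose proof (pos_INR j); lra).
  apply (ex_series_DAlembert _ (1 / 2)); [lra| |].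
  - intros n. apply Rmult_integral_contrapositive_currified; apply pow_nonzero;
      pose proof (P n); lra.
  - apply (is_lim_seq_ext (fun n => (1 + / (INR n + 1)) ^ q * (1 / 2))).
    { intros n. pose proof (P n). rewrite S_INR, Rabs_pos_eq.
      - assert (E : (INR n + 1 + 1) ^ q = (1 + / (INR n + 1)) ^ q * (INR n + 1) ^ q).
        { rewrite <- Rpow_mult_distr. f_equal. field. lra. }
        change ((1 / 2) ^ S n) with (1 / 2 * (1 / 2) ^ n). rewrite E.
        field. repeat split; apply pow_nonzero; lra.
      - apply Rmult_le_pos; [|left; apply Rinv_0_lt_compat];
          try left; apply Rmult_lt_0_compat; apply pow_lt; lra. }
    replace (Finite (1 / 2)) with (Rbar_mult (1 ^ q) (1 / 2)) by (simpl; f_equal; rewrite pow1; ring).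
    apply is_lim_seq_scal_r.
    induction q as [|q IH]; [simpl; apply is_lim_seq_const|].
    simpl pow. replace (Finite (1 * 1 ^ q)) with (Rbar_mult 1 (1 ^ q)) by reflexivity.
    apply (is_lim_seq_mult _ _ 1 (1 ^ q)); [|exact IH|reflexivity].
    replace (Finite 1) with (Rbar_plus 1 0) by (simpl; f_equal; ring).
    apply (is_lim_seq_plus _ _ 1 0); [apply is_lim_seq_const| |reflexivity].
    apply (is_lim_seq_ext (fun n => / INR (S n))); [intros n; now rewrite S_INR|].
    apply is_lim_seq_incr_1 with (u := fun n => / INR n).
    replace (Finite 0) with (Rbar_inv p_infty) by reflexivity.
    apply is_lim_seq_inv; [apply is_lim_seq_INR|discriminate].
Qed.

(** * Sobolev norms from sup norms and spectra in the multiples of [N] *)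

Definition spectrum (N d : nat) (f : R -> R) : Prop :=
  continuity f /\
  forall k th, ~ (exists k', k = (Z.of_nat N * k')%Z /\ (Z.abs k' <= Z.of_nat d)%Z) ->
    fcoef f k th = 0.

Lemma spectrum_lin (N d : nat) (a b : R) (f g : R -> R) :
  spectrum N d f -> spectrum N d g -> spectrum N d (fun x => a * f x + b * g x).
Proof.
  intros [Cf Hf] [Cg Hg]. split.
  - apply (continuity_plus (fun x => a * f x) (fun x => b * g x));
      apply continuity_scal; assumption.
  - intros k th Hk. rewrite fcoef_lin, Hf, Hg by auto. ring.
Qed.

(** The geometric factor is the decay of the norms of the [w_j]; the square is the price of two time
    derivatives of a term of degree at most [3 * j + 1]. *)
Definition majorant (j : nat) : R := (INR j + 1) ^ 2 * (1 / 2) ^ j.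

Lemma majorant_pos (j : nat) : 0 < majorant j.
Proof. pose proof (pos_INR j). apply Rmult_lt_0_compat; apply pow_lt; lra. Qed.

Lemma ex_series_majorant (eta : R) : ex_series (fun j => eta * majorant j).
Proof. apply (ex_series_scal (V := R_NormedModule)), ex_series_poly_geom. Qed.

(** These data suffice for all Sobolev norms: the sup norm bounds each Fourier coefficient, and the
    degree [3 * j + 1] tells which frequencies occur. Derivatives of the functions do not appear. *)
Definition family (N : nat) (eta : R) (f : nat -> R -> R) : Prop :=
  forall j, spectrum N (3 * j + 1) (f j) /\ forall x, Rabs (f j x) <= eta * majorant j.

Lemma family_fcoef_Series (N : nat) (eta : R) (f : nat -> R -> R) (k : Z) (th : R) :
  family N eta f ->
  is_series (fun j => fcoef (f j) k th) (fcoef (fun x => Series (fun j => f j x)) k th).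
Proof.
  intros Hf. apply (fcoef_Series f (fun j => eta * majorant j)); try apply Hf.
  apply ex_series_majorant.
Qed.

Lemma family_continuity (N : nat) (eta : R) (f : nat -> R -> R) :
  family N eta f -> continuity (fun x => Series (fun j => f j x)).
Proof.
  intros Hf. apply (Series_continuity f (fun j => eta * majorant j)); try apply Hf.
  apply ex_series_majorant.
Qed.

Lemma Series_zero (a : nat -> R) : (forall j, a j = 0) -> Series a = 0.
Proof.
  intros H. rewrite (Series_ext a (fun j => 0 * a j)) by (intros j; rewrite H; ring).
  rewrite Series_scal_l. ring.
Qed.

(** The frequency [N * k] occurs only in those [f j] with [|k| <= 3 * j + 1]. There the weight is at
    most a polynomial in [j], which the geometric factor of [majorant] absorbs. Hence the constant
    depends on [P] alone. *)
Lemma family_fcoef_decay (P : nat) : exists S, 0 < S /\ forall N eta f k th,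
  0 <= eta -> family N eta f -> (0 < N)%nat ->
  (1 + IZR k ^ 2) ^ P * Rabs (fcoef (fun x => Series (fun j => f j x)) (Z.of_nat N * k) th)
    <= S * eta.
Proof.
  set (b := fun j => (1 + (3 * INR j + 1) ^ 2) ^ P * majorant j).
  assert (Eb : ex_series b).
  { apply (ex_series_abs_le _ (fun j => 9 ^ P * ((INR j + 1) ^ (2 * P + 2) * (1 / 2) ^ j))).
    - intros j. unfold b. pose proof (majorant_pos j). pose proof (pos_INR j).
      rewrite Rabs_pos_eq by (apply Rmult_le_pos; [apply pow_le; nra | lra]).
      replace (9 ^ P * ((INR j + 1) ^ (2 * P + 2) * (1 / 2) ^ j)) with
        ((9 * (INR j + 1) ^ 2) ^ P * majorant j).
      + apply Rmult_le_compat_r; [lra|]. apply pow_incr. nra.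
      + unfold majorant. rewrite Rpow_mult_distr, <- pow_mult, pow_add. ring.
    - apply (ex_series_scal (V := R_NormedModule)), ex_series_poly_geom. }
  assert (Sb : 0 <= Series b).
  { apply Rle_trans with (Rabs (Series b)); [apply Rabs_pos|].
    apply Series_abs_le; auto. intros j. right. apply Rabs_pos_eq.
    unfold b. pose proof (majorant_pos j). apply Rmult_le_pos; [apply pow_le; nra|lra]. }
  pose proof PI_RGT_0 as HPI.
  exists (2 * PI * (Series b + 1)). split; [nra|].
  intros N eta f k th Heta Hf HN.
  assert (HX : 1 <= 1 + IZR k ^ 2) by (pose proof (pow2_ge_0 (IZR k)); lra).
  rewrite <- (is_series_unique _ _ (family_fcoef_Series _ _ _ (Z.of_nat N * k) th Hf)).
  rewrite <- (Rabs_pos_eq ((1 + IZR k ^ 2) ^ P)) by (apply pow_le; lra).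
  rewrite <- Rabs_mult, <- Series_scal_l.
  apply Rle_trans with (Series (fun j => (2 * PI * eta) * b j)).
  - apply Series_abs_le; [|apply (ex_series_scal (V := R_NormedModule)), Eb].
    intros j. destruct (Hf j) as [[Cj Zj] Bj].
    rewrite Rabs_mult, (Rabs_pos_eq (_ ^ P)) by (apply pow_le; lra).
    pose proof (majorant_pos j).
    destruct (Z_le_gt_dec (Z.abs k) (Z.of_nat (3 * j + 1))) as [Hk|Hk].
    + assert (HP : (1 + IZR k ^ 2) ^ P <= (1 + (3 * INR j + 1) ^ 2) ^ P).
      { apply pow_incr. split; [lra|]. apply IZR_le in Hk.
        rewrite <- INR_IZR_INZ, plus_INR, mult_INR, abs_IZR in Hk. simpl in Hk.
        rewrite <- (pow2_abs (IZR k)). pose proof (Rabs_pos (IZR k)).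
        assert (Rabs (IZR k) ^ 2 <= (3 * INR j + 1) ^ 2); [|lra]. apply pow_incr. lra. }
      pose proof (fcoef_bound (f j) (Z.of_nat N * k) th _ Cj Bj).
      assert (0 <= (1 + IZR k ^ 2) ^ P) by (apply pow_le; lra).
      apply Rle_trans with ((1 + IZR k ^ 2) ^ P * (2 * PI * (eta * majorant j))).
      * apply Rmult_le_compat_l; auto.
      * apply Rle_trans with ((1 + (3 * INR j + 1) ^ 2) ^ P * (2 * PI * (eta * majorant j))).
        -- apply Rmult_le_compat_r; auto. apply Rmult_le_pos; [lra|]. apply Rmult_le_pos; lra.
        -- unfold b. right; ring.
    + rewrite Zj.
      * rewrite Rabs_R0, Rmult_0_r. unfold b. apply Rmult_le_pos; [nra|].
        apply Rmult_le_pos; [apply pow_le; nra|lra].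
      * intros [k' [E1 E2]]. assert (k = k') by nia. subst. lia.
  - rewrite Series_scal_l. nra.
Qed.

(** At frequency [N * k] the weight is at most [N^(2 r) * (1 + k^2)^q] for an integer [q >= r]. The
    decay of the coefficients with the exponent [q + 1] compensates it and leaves the summable
    [1 / (1 + k^2)]. All of the dependence on [N] is in the factor [N^r]. *)
Lemma family_Hsum (r : R) : 0 <= r -> exists K, 0 < K /\ forall N eta f,
  (0 < N)%nat -> 0 <= eta -> family N eta f ->
  exists l, infinite_sum (Hterm r (fun x => Series (fun j => f j x))) l /\
    0 <= l <= K * (Rpower (INR N) r * eta) ^ 2.
Proof.
  intros Hr.
  destruct (archimed r) as [Hq _].
  set (q := Z.to_nat (up r)).
  assert (Hrq : r <= INR q).
  { unfold q. rewrite INR_IZR_INZ, Z2Nat.id; [lra|]. apply le_IZR. lra. }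
  destruct (family_fcoef_decay (S q)) as [S0 [HS0 HD]].
  pose proof PI_RGT_0 as HPI.
  exists (6 * (S0 ^ 2 / PI)). split.
  { apply Rmult_lt_0_compat; [lra|]. apply Rdiv_lt_0_compat; nra. }
  intros N eta f HN Heta Hf.
  set (F := fun x => Series (fun j => f j x)).
  rewrite Rmult_assoc. apply (Hsum_lacunary N); auto.
  - apply Rmult_le_pos; [|apply pow2_ge_0].
    apply Rmult_le_pos; [nra | left; apply Rinv_0_lt_compat; lra].
  - intros k Hk.
    assert (Z : forall th, fcoef F k th = 0).
    { intros th. unfold F.
      rewrite <- (is_series_unique _ _ (family_fcoef_Series _ _ _ k th Hf)).
      apply Series_zero. intros j. apply (Hf j). intros [k' [E _]]. apply Hk. now exists k'. }
    unfold fc2. rewrite Ck_fcoef, Sk_fcoef, !Z. unfold Rdiv. ring.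
  - intros k.
    assert (HN1 : 1 <= INR N) by (apply (le_INR 1); lia).
    set (X := 1 + IZR k ^ 2).
    assert (HX : 1 <= X) by (unfold X; pose proof (pow2_ge_0 (IZR k)); lra).
    assert (HW : weight r (Z.of_nat N * k) <= Rpower (INR N) r ^ 2 * X ^ q).
    { unfold weight. rewrite mult_IZR, <- INR_IZR_INZ.
      apply Rle_trans with (Rpower (INR N * INR N * X) r).
      - apply Rle_Rpower_l; [lra|]. unfold X. pose proof (pow2_ge_0 (IZR k)).
        split; nra.
      - rewrite <- !Rpower_mult_distr by nra.
        replace (Rpower (INR N) r ^ 2) with (Rpower (INR N) r * Rpower (INR N) r) by ring.
        apply Rmult_le_compat_l; [left; apply Rmult_lt_0_compat; apply exp_pos|].
        rewrite <- (Rpower_pow q X) by lra. apply Rle_Rpower; lra. }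
    assert (HC : fc2 F (Z.of_nat N * k) * (X ^ S q) ^ 2 <= (S0 * eta) ^ 2 / PI).
    { unfold fc2. rewrite Ck_fcoef, Sk_fcoef.
      assert (A : forall th, fcoef F (Z.of_nat N * k) th ^ 2 * (X ^ S q) ^ 2 <= (S0 * eta) ^ 2).
      { intros th. specialize (HD N eta f k th Heta Hf HN). fold F X in HD.
        rewrite <- Rpow_mult_distr, <- pow2_abs, Rabs_mult, (Rabs_pos_eq (X ^ S q))
          by (apply pow_le; lra).
        apply pow_incr. split; [|lra].
        apply Rmult_le_pos; [apply Rabs_pos|apply pow_le; lra]. }
      pose proof (A 0). pose proof (A (- (PI / 2))).
      apply Rmult_le_reg_r with (2 * PI); [lra|].
      set (c := fcoef F _ 0 ^ 2) in *. set (c' := fcoef F _ (- (PI / 2)) ^ 2) in *.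
      replace ((c + c') / (2 * PI) * (X ^ S q) ^ 2 * (2 * PI)) with ((c + c') * (X ^ S q) ^ 2)
        by (field; lra).
      replace ((S0 * eta) ^ 2 / PI * (2 * PI)) with (2 * (S0 * eta) ^ 2) by (field; lra).
      rewrite Rmult_plus_distr_r. lra. }
    pose proof (fc2_nonneg F (Z.of_nat N * k)) as HF0.
    set (c := fc2 F _) in *. set (n := Rpower (INR N) r) in *.
    assert (Hn : 0 <= n ^ 2) by apply pow2_ge_0.
    change (1 + IZR k ^ 2) with X. apply (proj1 (Rle_div_r _ _ X ltac:(lra))).
    apply Rle_trans with (n ^ 2 * (c * (X ^ S q) ^ 2)).
    + apply Rle_trans with (n ^ 2 * X ^ q * c * X).
      * apply Rmult_le_compat_r; [lra|]. apply Rmult_le_compat_r; auto.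
      * replace (n ^ 2 * X ^ q * c * X) with (n ^ 2 * (c * X ^ S q)) by (simpl; ring).
        apply Rmult_le_compat_l; auto. apply Rmult_le_compat_l; auto.
        assert (1 <= X ^ S q) by (apply pow_R1_Rle; lra). nra.
    + replace (S0 ^ 2 / PI * (n * eta) ^ 2) with (n ^ 2 * ((S0 * eta) ^ 2 / PI)) by (field; lra).
      apply Rmult_le_compat_l; auto.
Qed.

(** * Formal trigonometric polynomials *)

(** The list of the [(k, phi, c)] stands for the sum of the [c * cos (k * y + phi)]. Since the
    lists are formal sums, products, derivatives and Fourier multipliers act term by term and
    [tnorm] is submultiplicative. *)
Definition trigpoly := list (Z * R * R).

Fixpoint ev (l : trigpoly) (y : R) : R :=
  match l with
  | [] => 0
  | (k, phi, c) :: l' => c * cos (IZR k * y + phi) + ev l' y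
  end.

Fixpoint tnorm (l : trigpoly) : R :=
  match l with
  | [] => 0
  | (_, _, c) :: l' => Rabs c + tnorm l'
  end.

Definition degree_le (d : nat) (l : trigpoly) : Prop :=
  Forall (fun m => (Z.abs (fst (fst m)) <= Z.of_nat d)%Z) l.

Definition tscal (a : R) (l : trigpoly) : trigpoly :=
  map (fun '(k, phi, c) => (k, phi, a * c)) l.

(** The phase shift writes [- sin] as a cosine, so that the format is closed under differentiation
    without a second kind of term. *)
Definition tderiv (l : trigpoly) : trigpoly :=
  map (fun '(k, phi, c) => (k, phi + PI / 2, IZR k * c)) l.

(** The multiplier [d_x Lambda^{-2}] acting on [x => ev l (N * (x + b))]. *)
Definition tdxLm2 (N : nat) (l : trigpoly) : trigpoly :=
  map (fun '(k, phi, c) => (k, phi + PI / 2, mult (Z.of_nat N * k) * c)) l.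

Definition tmul_mono (k : Z) (phi c : R) (l : trigpoly) : trigpoly :=
  flat_map (fun '(k', phi', c') =>
    [((k + k')%Z, phi + phi', c * c' / 2); ((k - k')%Z, phi - phi', c * c' / 2)]) l.

Definition tmul (l l' : trigpoly) : trigpoly :=
  flat_map (fun '(k, phi, c) => tmul_mono k phi c l') l.

Lemma tnorm_nonneg (l : trigpoly) : 0 <= tnorm l.
Proof.
  induction l as [|[[k phi] c] l IH]; simpl; [lra|]. pose proof (Rabs_pos c). lra.
Qed.

Lemma ev_app (l l' : trigpoly) (y : R) : ev (l ++ l') y = ev l y + ev l' y.
Proof. induction l as [|[[k phi] c] l IH]; simpl; [ring|]. rewrite IH. ring. Qed.

Lemma tnorm_app (l l' : trigpoly) : tnorm (l ++ l') = tnorm l + tnorm l'.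
Proof. induction l as [|[[k phi] c] l IH]; simpl; [ring|]. rewrite IH. ring. Qed.

Lemma ev_tscal (a : R) (l : trigpoly) (y : R) : ev (tscal a l) y = a * ev l y.
Proof. induction l as [|[[k phi] c] l IH]; simpl; [ring|]. rewrite IH. ring. Qed.

Lemma tnorm_tscal (a : R) (l : trigpoly) : tnorm (tscal a l) = Rabs a * tnorm l.
Proof. induction l as [|[[k phi] c] l IH]; simpl; [ring|]. rewrite IH, Rabs_mult. ring. Qed.

Lemma ev_tmul (l l' : trigpoly) (y : R) : ev (tmul l l') y = ev l y * ev l' y.
Proof.
  assert (A : forall k phi c, ev (tmul_mono k phi c l') y = c * cos (IZR k * y + phi) * ev l' y).
  { intros k phi c. induction l' as [|[[k' phi'] c'] l' IH]; simpl; [ring|].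
    fold (tmul_mono k phi c l'). rewrite IH, plus_IZR, minus_IZR.
    replace ((IZR k + IZR k') * y + (phi + phi'))
      with ((IZR k * y + phi) + (IZR k' * y + phi')) by ring.
    replace ((IZR k - IZR k') * y + (phi - phi'))
      with ((IZR k * y + phi) - (IZR k' * y + phi')) by ring.
    rewrite cos_plus, cos_minus. field. }
  induction l as [|[[k phi] c] l IH]; simpl; [ring|].
  rewrite ev_app, A. fold (tmul l l'). rewrite IH. ring.
Qed.

(** An equality, because like terms are never collected: each product of cosines becomes two terms
    with half of the coefficient. *)
Lemma tnorm_tmul (l l' : trigpoly) : tnorm (tmul l l') = tnorm l * tnorm l'.
Proof.
  assert (A : forall k phi c, tnorm (tmul_mono k phi c l') = Rabs c * tnorm l').
  { intros k phi c. induction l' as [|[[k' phi'] c'] l' IH]; simpl; [ring|].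
    fold (tmul_mono k phi c l'). rewrite IH. unfold Rdiv. rewrite !Rabs_mult.
    rewrite (Rabs_pos_eq (/ 2)) by lra. field. }
  induction l as [|[[k phi] c] l IH]; simpl; [ring|].
  rewrite tnorm_app, A. fold (tmul l l'). rewrite IH. ring.
Qed.

Lemma ev_bound (l : trigpoly) (y : R) : Rabs (ev l y) <= tnorm l.
Proof.
  induction l as [|[[k phi] c] l IH]; simpl; [rewrite Rabs_R0; lra|].
  eapply Rle_trans; [apply Rabs_triang|]. apply Rplus_le_compat; [|exact IH].
  rewrite Rabs_mult. pose proof (Rabs_pos c).
  assert (Rabs (cos (IZR k * y + phi)) <= 1) by (apply Rabs_le, COS_bound). nra.
Qed.

Lemma degree_le_app (d : nat) (l l' : trigpoly) :
  degree_le d l -> degree_le d l' -> degree_le d (l ++ l').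
Proof. intros; apply Forall_app; auto. Qed.

Lemma degree_le_mono (d d' : nat) (l : trigpoly) :
  (d <= d')%nat -> degree_le d l -> degree_le d' l.
Proof. intros Hd. apply Forall_impl. intros [[k phi] c]; simpl. lia. Qed.

Lemma degree_le_map (d : nat) (g : Z * R * R -> Z * R * R) (l : trigpoly) :
  (forall m, fst (fst (g m)) = fst (fst m)) -> degree_le d l -> degree_le d (map g l).
Proof.
  intros Hg H. apply Forall_map. revert H. apply Forall_impl. intros m. now rewrite Hg.
Qed.

Lemma degree_le_tscal (d : nat) (a : R) (l : trigpoly) :
  degree_le d l -> degree_le d (tscal a l).
Proof. apply degree_le_map. now intros [[k phi] c]. Qed.

Lemma degree_le_tderiv (d : nat) (l : trigpoly) : degree_le d l -> degree_le d (tderiv l).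
Proof. apply degree_le_map. now intros [[k phi] c]. Qed.

Lemma degree_le_tdxLm2 (d N : nat) (l : trigpoly) : degree_le d l -> degree_le d (tdxLm2 N l).
Proof. apply degree_le_map. now intros [[k phi] c]. Qed.

Lemma degree_le_tmul (d d' : nat) (l l' : trigpoly) :
  degree_le d l -> degree_le d' l' -> degree_le (d + d') (tmul l l').
Proof.
  intros H H'. apply Forall_flat_map. revert H. apply Forall_impl. intros [[k phi] c] Hk.
  apply Forall_flat_map. revert H'. apply Forall_impl. intros [[k' phi'] c'] Hk'. simpl in *.
  repeat constructor; simpl; lia.
Qed.

Lemma tnorm_tderiv (d : nat) (l : trigpoly) :
  degree_le d l -> tnorm (tderiv l) <= INR d * tnorm l.
Proof.
  induction 1 as [|[[k phi] c] l Hk Hl IH]; simpl; [lra|].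
  fold (tderiv l). rewrite Rabs_mult. simpl in Hk. apply IZR_le in Hk.
  rewrite abs_IZR, <- INR_IZR_INZ in Hk. pose proof (Rabs_pos c). nra.
Qed.

(** The symbol at [N * k] is at most [1 / (N * |k|)] for [k <> 0] and vanishes at 0. So the operator
    gains a factor [1 / N] even after one further derivative in [y]. *)
Lemma tnorm_tdxLm2 (N : nat) (l : trigpoly) : (0 < N)%nat ->
  tnorm (tdxLm2 N l) <= / INR N * tnorm l /\
  tnorm (tderiv (tdxLm2 N l)) <= / INR N * tnorm l.
Proof.
  intros HN. assert (HN' : 0 < INR N) by (apply lt_0_INR; lia).
  induction l as [|[[k phi] c] l IH]; simpl; [lra|].
  fold (tdxLm2 N l). fold (tderiv (tdxLm2 N l)). rewrite !Rabs_mult.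
  assert (A : Rabs (mult (Z.of_nat N * k)) <= / INR N /\
    Rabs (IZR k) * Rabs (mult (Z.of_nat N * k)) <= / INR N).
  { unfold mult. rewrite mult_IZR, <- INR_IZR_INZ. set (n := INR N) in *.
    unfold Rdiv. rewrite !Rabs_mult, (Rabs_pos_eq n) by lra.
    assert (HX : 0 < 1 + (n * IZR k) ^ 2) by (pose proof (pow2_ge_0 (n * IZR k)); lra).
    rewrite (Rabs_pos_eq (/ _)) by (left; apply Rinv_0_lt_compat, HX).
    assert (B : n * IZR k ^ 2 * / (1 + (n * IZR k) ^ 2) <= / n).
    { apply Rmult_le_reg_r with (1 + (n * IZR k) ^ 2); [exact HX|].
      apply Rmult_le_reg_l with n; [exact HN'|]. field_simplify; nra. }
    (* True because [k] is an integer; it reduces the bound without derivative to the one with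
       derivative. *)
    assert (Hk : Rabs (IZR k) <= IZR k ^ 2).
    { rewrite <- pow2_abs, <- abs_IZR, <- Rsqr_pow2. unfold Rsqr. rewrite <- mult_IZR.
      apply IZR_le. nia. }
    pose proof (Rinv_0_lt_compat _ HX). pose proof (Rabs_pos (IZR k)).
    split.
    - apply Rle_trans with (n * IZR k ^ 2 * / (1 + (n * IZR k) ^ 2)); auto.
      apply Rmult_le_compat_r; [lra|]. nra.
    - eapply Rle_trans; [|exact B]. right. rewrite <- (pow2_abs (IZR k)). ring. }
  destruct A as [A1 A2], IH as [IH1 IH2]. pose proof (Rabs_pos c).
  split; nra.
Qed.

Lemma ev_derive (l : trigpoly) (y : R) : is_derive (ev l) y (ev (tderiv l) y).
Proof.
  induction l as [|[[k phi] c] l IH]; simpl.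
  - apply (is_derive_const (V := R_NormedModule)).
  - apply (is_derive_plus (V := R_NormedModule) (fun y => c * cos (IZR k * y + phi)) (ev l));
      [|exact IH].
    auto_derive; auto.
    replace (IZR k * y + (phi + PI / 2)) with ((IZR k * y + phi) + PI / 2) by ring.
    rewrite cos_plus, cos_PI2, sin_PI2. ring.
Qed.

Lemma ev_shift (N : nat) (b : R) (k : Z) (phi x : R) :
  cos (IZR k * (INR N * (x + b)) + phi) =
  cos (IZR (Z.of_nat N * k) * x + (IZR k * INR N * b + phi)).
Proof. rewrite mult_IZR, <- INR_IZR_INZ. f_equal. ring. Qed.

Lemma ev_continuity (N : nat) (b : R) (l : trigpoly) :
  continuity (fun x => ev l (INR N * (x + b))).
Proof.
  induction l as [|[[k phi] c] l IH]; simpl; [apply continuity_const; now intros x y|].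
  apply (continuity_plus (fun x => c * cos _)); [|exact IH].
  apply (continuity_scal (fun x => cos _)).
  replace (fun x => cos _) with
    (fun x => cos (IZR (Z.of_nat N * k) * x + (IZR k * INR N * b + phi)))
    by (apply functional_extensionality; intros x; now rewrite ev_shift).
  apply continuity_cos_affine.
Qed.

Lemma ev_periodic (N : nat) (b : R) (l : trigpoly) :
  periodic (fun x => ev l (INR N * (x + b))).
Proof.
  intros x. induction l as [|[[k phi] c] l IH]; simpl; [reflexivity|].
  rewrite IH, !ev_shift. do 2 f_equal.
  rewrite <- (proj1 (cos_sin_period_Z (IZR (Z.of_nat N * k) * x + _) (Z.of_nat N * k))).
  f_equal. ring.
Qed.

Lemma fcoef_ev_cons (N : nat) (b : R) (k : Z) (phi c : R) (l : trigpoly) (q : Z) (th : R) :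
  fcoef (fun x => ev ((k, phi, c) :: l) (INR N * (x + b))) q th =
  c * fcoef (fun x => cos (IZR (Z.of_nat N * k) * x + (IZR k * INR N * b + phi))) q th +
  fcoef (fun x => ev l (INR N * (x + b))) q th.
Proof.
  rewrite <- (Rmult_1_l (fcoef (fun x => ev l _) q th)).
  rewrite <- fcoef_lin; [|apply continuity_cos_affine|apply ev_continuity].
  f_equal. apply functional_extensionality; intros x. simpl. rewrite ev_shift. ring.
Qed.

Lemma fcoef_ev_nil (q : Z) (th : R) : fcoef (fun _ => 0) q th = 0.
Proof.
  replace (fun _ => 0) with (fun x : R => 0 * x + 0 * x)
    by (apply functional_extensionality; intros x; ring).
  rewrite fcoef_lin by (apply derivable_continuous, derivable_id). ring.
Qed.

Lemma ev_spectrum (N d : nat) (b : R) (l : trigpoly) :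
  degree_le d l -> spectrum N d (fun x => ev l (INR N * (x + b))).
Proof.
  intros H. split; [apply ev_continuity|]. intros q th Hq.
  induction H as [|[[k phi] c] l Hk Hl IH]; [apply fcoef_ev_nil|].
  rewrite fcoef_ev_cons, IH, fcoef_cos. simpl in Hk.
  destruct (Z.eq_dec _ 0) as [E|_].
  { exfalso. apply Hq. exists (- k)%Z. lia. }
  destruct (Z.eq_dec _ 0) as [E|_]; [|ring].
  exfalso. apply Hq. exists k. lia.
Qed.

(** Multiplication by [i] is a quarter turn, moved here from the phase of the function to the phase
    [th] of the coefficient. At frequency [- q] the turn has the opposite sense, and the resulting
    sign is that of the odd symbol [mult]. *)
Lemma ev_tdxLm2_coef (N : nat) (b : R) (l : trigpoly) (q : Z) (th : R) :
  fcoef (fun x => ev (tdxLm2 N l) (INR N * (x + b))) q th =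
  mult q * fcoef (fun x => ev l (INR N * (x + b))) q (th - PI / 2).
Proof.
  induction l as [|[[k phi] c] l IH]; [simpl; rewrite !fcoef_ev_nil; ring|].
  change (tdxLm2 N ((k, phi, c) :: l)) with
    ((k, phi + PI / 2, mult (Z.of_nat N * k) * c) :: tdxLm2 N l).
  rewrite !fcoef_ev_cons, IH, !fcoef_cos.
  set (m := (Z.of_nat N * k)%Z). set (be := IZR k * INR N * b).
  destruct (Z.eq_dec (m + q) 0) as [E1|E1]; destruct (Z.eq_dec (m - q) 0) as [E2|E2].
  - replace q with 0%Z by lia. replace m with 0%Z by lia. unfold mult. simpl. field.
  - replace m with (- q)%Z by lia.
    replace (be + (phi + PI / 2) + th) with (be + phi + (th - PI / 2) + PI) by field.
    rewrite neg_cos. unfold mult. rewrite opp_IZR. field. pose proof (pow2_ge_0 (IZR q)). nra.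
  - replace m with q by lia.
    replace (be + (phi + PI / 2) - th) with (be + phi - (th - PI / 2)) by field. ring.
  - ring.
Qed.

(** * The formal power series solution *)

Fixpoint tsum (f : nat -> trigpoly) (n : nat) : trigpoly :=
  match n with O => f O | S n' => tsum f n' ++ f (S n') end.

Definition smul (a b : nat -> trigpoly) (j : nat) : trigpoly :=
  tsum (fun i => tmul (a i) (b (j - i)%nat)) j.

Definition sderiv (a : nat -> trigpoly) (j : nat) : trigpoly := tderiv (a j).

Lemma ev_smul (a b : nat -> trigpoly) (y : R) (j : nat) :
  ev (smul a b j) y = PS_mult (fun i => ev (a i) y) (fun i => ev (b i) y) j.
Proof.
  assert (A : forall f n, ev (tsum f n) y = sum_f_R0 (fun i => ev (f i) y) n).
  { intros f. induction n as [|n IH]; simpl; [reflexivity|]. now rewrite ev_app, IH. }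
  unfold smul, PS_mult. rewrite A. apply sum_eq. intros i _. apply ev_tmul.
Qed.

Lemma tnorm_smul (a b : nat -> trigpoly) (j : nat) :
  tnorm (smul a b j) = PS_mult (fun i => tnorm (a i)) (fun i => tnorm (b i)) j.
Proof.
  assert (A : forall f n, tnorm (tsum f n) = sum_f_R0 (fun i => tnorm (f i)) n).
  { intros f. induction n as [|n IH]; simpl; [reflexivity|]. now rewrite tnorm_app, IH. }
  unfold smul, PS_mult. rewrite A. apply sum_eq. intros i _. apply tnorm_tmul.
Qed.

(** The offsets [p] add up under products. The quartic term turns offset 1 into 4, and
    [3 * j + 4 = 3 * S j + 1]: this is the origin of the slope 3 and lets the degree bound reproduce
    itself in the recursion. *)
Definition sdegree (p : nat) (a : nat -> trigpoly) (j : nat) : Prop :=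
  forall i, (i <= j)%nat -> degree_le (3 * i + p) (a i).

Lemma sdegree_smul (p q j : nat) (a b : nat -> trigpoly) :
  sdegree p a j -> sdegree q b j -> sdegree (p + q) (smul a b) j.
Proof.
  intros Ha Hb i Hi. unfold smul.
  assert (A : forall f n, (forall l, (l <= n)%nat -> degree_le (3 * i + (p + q)) (f l)) ->
    degree_le (3 * i + (p + q)) (tsum f n)).
  { intros f. induction n as [|n IH]; intros H; simpl; [apply H; lia|].
    apply degree_le_app; [apply IH; intros; apply H; lia | apply H; lia]. }
  apply A. intros l Hl.
  apply (degree_le_mono (3 * l + p + (3 * (i - l) + q))); [lia|].
  apply degree_le_tmul; [apply Ha; lia|apply Hb; lia].
Qed.

Lemma sdegree_sderiv (p j : nat) (a : nat -> trigpoly) :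
  sdegree p a j -> sdegree p (sderiv a) j.
Proof. intros H i Hi. apply degree_le_tderiv, H, Hi. Qed.

Lemma smul_ext (a a' b b' : nat -> trigpoly) (j : nat) :
  (forall i, (i <= j)%nat -> a i = a' i) -> (forall i, (i <= j)%nat -> b i = b' i) ->
  smul a b j = smul a' b' j.
Proof.
  intros Ha Hb. unfold smul.
  assert (A : forall f g n, (forall l, (l <= n)%nat -> f l = g l) -> tsum f n = tsum g n).
  { intros f g. induction n as [|n IH]; intros H; simpl; [apply H; lia|].
    rewrite IH, H; auto. }
  apply A. intros l Hl. rewrite Ha, Hb; auto; lia.
Qed.

(** [G] sees all earlier values, not only the last one. The sequence [P J] is the result of [J]
    rounds of the recursion; by causality its values up to the index [J] are final, so the diagonal
    solves the recursion. *)
Lemma causal_recursion {T : Type} (a0 : T) (G : (nat -> T) -> nat -> T) :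
  (forall f g j, (forall i, (i <= j)%nat -> f i = g i) -> G f j = G g j) ->
  exists w, w O = a0 /\ forall j, w (S j) = G w j.
Proof.
  intros HG.
  set (P := fix P J : nat -> T := match J with
            | O => fun _ => a0
            | S J' => fun j => match j with O => a0 | S j' => G (P J') j' end end).
  assert (A : forall J j, (j <= J)%nat -> P (S J) j = P J j).
  { induction J as [|J IH]; intros [|j] Hj; try reflexivity; [lia|].
    apply HG. intros i Hi. apply IH. lia. }
  assert (B : forall d j, P (d + j)%nat j = P j j).
  { induction d as [|d IH]; intros j; [reflexivity|]. rewrite <- IH. apply A. lia. }
  exists (fun j => P j j). split; [reflexivity|]. intros j.
  apply HG. intros i Hi. rewrite <- (B (j - i)%nat i), Nat.sub_add by lia. reflexivity.
Qed.

(** * Majorization by weighted partial sums *)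

Lemma PS_mult_le (a a' b b' : nat -> R) (j : nat) :
  (forall i, 0 <= a i <= a' i) -> (forall i, 0 <= b i <= b' i) ->
  0 <= PS_mult a b j <= PS_mult a' b' j.
Proof.
  intros Ha Hb. unfold PS_mult. split.
  - apply cond_pos_sum. intros i. apply Rmult_le_pos; [apply Ha|apply Hb].
  - apply sum_Rle. intros i _. pose proof (Ha i). pose proof (Hb (j - i)%nat).
    apply Rmult_le_compat; lra.
Qed.

(** The partial sum of the power series at [t = 2]. A bound uniform in [J] gives a radius of
    convergence of at least 2 and decay like [(1 / 2) ^ j] on [0, 1]. *)
Definition psum (a : nat -> R) (J : nat) : R := sum_f_R0 (fun j => a j * 2 ^ j) J.

Lemma psum_nonneg (a : nat -> R) (J : nat) : (forall i, 0 <= a i) -> 0 <= psum a J.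
Proof.
  intros H. apply cond_pos_sum. intros i. apply Rmult_le_pos; [apply H|apply pow_le; lra].
Qed.

(** The truncated Cauchy product is a part of the product of the truncations, and for nonnegative
    sequences the omitted terms, [rest] below, only add. This keeps the induction on partial sums
    within finite sums. *)
Lemma psum_mult_le (a b : nat -> R) (J : nat) :
  (forall i, 0 <= a i) -> (forall i, 0 <= b i) ->
  psum (PS_mult a b) J <= psum a J * psum b J.
Proof.
  intros Ha Hb.
  assert (Pa : forall i, 0 <= a i * 2 ^ i).
  { intros i. apply Rmult_le_pos; [apply Ha|apply pow_le; lra]. }
  assert (Pb : forall i, 0 <= b i * 2 ^ i).
  { intros i. apply Rmult_le_pos; [apply Hb|apply pow_le; lra]. }
  unfold psum. destruct J as [|J]; [unfold PS_mult; simpl; lra|].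
  rewrite cauchy_finite by lia.
  set (rest := sum_f_R0 _ (pred (S J))).
  assert (0 <= rest).
  { apply cond_pos_sum. intros i. apply cond_pos_sum. intros l. apply Rmult_le_pos; auto. }
  assert (E : sum_f_R0 (fun j => PS_mult a b j * 2 ^ j) (S J) =
    sum_f_R0 (fun k => sum_f_R0 (fun p => a p * 2 ^ p * (b (k - p)%nat * 2 ^ (k - p))) k) (S J)).
  { apply sum_eq. intros k _. unfold PS_mult. rewrite Rmult_comm, scal_sum.
    apply sum_eq. intros i Hi.
    replace (2 ^ k) with (2 ^ i * 2 ^ (k - i)) by (rewrite <- pow_add; f_equal; lia). ring. }
  rewrite E. lra.
Qed.

(** The Taylor polynomial of [Rnl] at the constant [m], without its constant term: for the
    expansions [w] and [p] of [W] and its derivative, this expands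
    [Rnl (m + e * W) (e * N * p) - Rnl m 0]. *)
Definition srem (N : nat) (e m : R) (w : nat -> trigpoly) (j : nat) : trigpoly :=
  tscal (7 * e ^ 2 * INR N ^ 2) (smul (sderiv w) (sderiv w) j) ++
  tscal ((-12 * m ^ 3 + 6 * m ^ 2 - 20 * m - 2) * e) (w j) ++
  tscal ((-18 * m ^ 2 + 6 * m - 10) * e ^ 2) (smul w w j) ++
  tscal ((-12 * m + 2) * e ^ 3) (smul (smul w w) w j) ++
  tscal (-3 * e ^ 4) (smul (smul w w) (smul w w) j).

(** The coefficient of [t^j] in [w_t = 14 e N w w_y + (1 / e) d_x Lambda^{-2} (...)], divided by
    [j + 1]. The factor [1 / e] comes from [u = m + e * w]; the linear transport is missing because
    [w] is written in the frame moving with speed [c]. *)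
Definition srhs (N : nat) (e m : R) (w : nat -> trigpoly) (j : nat) : trigpoly :=
  tscal (/ INR (S j))
    (tscal (14 * e * INR N) (smul w (sderiv w) j) ++ tscal (/ e) (tdxLm2 N (srem N e m w j))).

Lemma srhs_causal (N : nat) (e m : R) (f g : nat -> trigpoly) (j : nat) :
  (forall i, (i <= j)%nat -> f i = g i) -> srhs N e m f j = srhs N e m g j.
Proof.
  intros H.
  assert (HD : forall i, (i <= j)%nat -> sderiv f i = sderiv g i).
  { intros i Hi. unfold sderiv. now rewrite H. }
  assert (H2 : forall i, (i <= j)%nat -> smul f f i = smul g g i).
  { intros i Hi. apply smul_ext; intros; apply H; lia. }
  unfold srhs, srem.
  rewrite (smul_ext f g (sderiv f) (sderiv g)), (smul_ext (sderiv f) (sderiv g) (sderiv f) (sderiv g)),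
    (smul_ext (smul f f) (smul g g) f g), (smul_ext (smul f f) (smul g g) (smul f f) (smul g g)),
    (H2 j), (H j) by auto. reflexivity.
Qed.

Lemma sdegree_srem (N : nat) (e m : R) (w : nat -> trigpoly) (j : nat) :
  sdegree 1 w j -> sdegree 4 (srem N e m w) j.
Proof.
  intros H. pose proof (sdegree_sderiv _ _ _ H) as HD.
  pose proof (sdegree_smul _ _ _ _ _ H H) as H2.
  pose proof (sdegree_smul _ _ _ _ _ HD HD) as HD2.
  pose proof (sdegree_smul _ _ _ _ _ H2 H) as H3.
  pose proof (sdegree_smul _ _ _ _ _ H2 H2) as H4.
  intros i Hi. repeat apply degree_le_app; apply degree_le_tscal.
  - apply (degree_le_mono (3 * i + (1 + 1))); [lia|]. now apply HD2.
  - apply (degree_le_mono (3 * i + 1)); [lia|]. now apply H.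
  - apply (degree_le_mono (3 * i + (1 + 1))); [lia|]. now apply H2.
  - apply (degree_le_mono (3 * i + (1 + 1 + 1))); [lia|]. now apply H3.
  - apply (degree_le_mono (3 * i + (1 + 1 + (1 + 1)))); [lia|]. now apply H4.
Qed.

Lemma sdegree_srhs (N : nat) (e m : R) (w : nat -> trigpoly) (j : nat) :
  sdegree 1 w j -> degree_le (3 * S j + 1) (srhs N e m w j).
Proof.
  intros H. pose proof (sdegree_sderiv _ _ _ H) as HD.
  pose proof (sdegree_smul _ _ _ _ _ H HD) as H2.
  apply degree_le_tscal, degree_le_app; apply degree_le_tscal.
  - apply (degree_le_mono (3 * j + (1 + 1))); [lia|]. now apply H2.
  - apply degree_le_tdxLm2. apply (degree_le_mono (3 * j + 4)); [lia|].
    now apply (sdegree_srem N e m w j H).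
Qed.

(** The derivative belongs to the norm because [srem] contains the square of [w_y]. All products are
    then bounded by Cauchy products of [wnorm], and only the derivative of [w * w_y] has to be
    estimated through its degree. *)
Definition wnorm (w : nat -> trigpoly) (j : nat) : R := tnorm (w j) + tnorm (sderiv w j).

(** The constants 40, 34 and 14 are the sums of the absolute values of the coefficients of the
    polynomials in [m], as [0 <= m <= 1]. *)
Lemma tnorm_srem_le (N : nat) (e m : R) (w : nat -> trigpoly) (j : nat) :
  0 < e -> 0 <= m <= 1 ->
  let a := wnorm w in
  let aa := PS_mult a a in
  tnorm (srem N e m w j) <= 7 * e ^ 2 * INR N ^ 2 * aa j + 40 * e * a j + 34 * e ^ 2 * aa j +
    14 * e ^ 3 * PS_mult aa a j + 3 * e ^ 4 * PS_mult aa aa j.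
Proof.
  intros He Hm a aa.
  assert (Hw : forall i, 0 <= tnorm (w i) <= a i).
  { intros i. unfold a, wnorm. pose proof (tnorm_nonneg (w i)).
    pose proof (tnorm_nonneg (sderiv w i)). lra. }
  assert (Hp : forall i, 0 <= tnorm (sderiv w i) <= a i).
  { intros i. unfold a, wnorm. pose proof (tnorm_nonneg (w i)).
    pose proof (tnorm_nonneg (sderiv w i)). lra. }
  assert (H2 : forall i, 0 <= tnorm (smul w w i) <= aa i).
  { intros i. rewrite tnorm_smul. apply PS_mult_le; auto. }
  assert (HD2 : 0 <= tnorm (smul (sderiv w) (sderiv w) j) <= aa j).
  { rewrite tnorm_smul. apply PS_mult_le; auto. }
  assert (H3 : 0 <= tnorm (smul (smul w w) w j) <= PS_mult aa a j).
  { rewrite tnorm_smul. apply PS_mult_le; auto. }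
  assert (H4 : 0 <= tnorm (smul (smul w w) (smul w w) j) <= PS_mult aa aa j).
  { rewrite tnorm_smul. apply PS_mult_le; auto. }
  unfold srem. rewrite !tnorm_app, !tnorm_tscal.
  assert (T : forall c C x X, Rabs c <= C -> 0 <= x <= X -> Rabs c * x <= C * X).
  { intros c C x X Hc Hx. apply Rmult_le_compat; try lra. apply Rabs_pos. }
  assert (P2 : 0 <= m ^ 2 <= 1) by nra. assert (P3 : 0 <= m ^ 3 <= 1) by (simpl; nra).
  assert (Pe : forall q, 0 < e ^ q) by (intros; apply pow_lt; lra).
  assert (Q : forall c C q, Rabs c <= C -> Rabs (c * e ^ q) <= C * e ^ q).
  { intros c C q Hc. rewrite Rabs_mult, (Rabs_pos_eq (e ^ q)) by (left; apply Pe).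
    apply Rmult_le_compat_r; [left; apply Pe|exact Hc]. }
  rewrite !Rplus_assoc.
  apply Rplus_le_compat; [|apply Rplus_le_compat; [|apply Rplus_le_compat;
    [|apply Rplus_le_compat]]]; apply T; auto.
  - rewrite Rabs_pos_eq; [lra|]. pose proof (Pe 2%nat). pose proof (pow2_ge_0 (INR N)). nra.
  - rewrite <- (pow_1 e). apply Q. apply Rabs_le. lra.
  - apply Q. apply Rabs_le. lra.
  - apply Q. apply Rabs_le. lra.
  - apply Q. apply Rabs_le. lra.
Qed.

(** Since [w * w_y] has degree at most [3 * j + 2], its norm and that of its derivative cost
    together [3 * (j + 1)], which cancels the division by [j + 1] and leaves [42 = 14 * 3]. The
    nonlocal part carries [2 / (e * N)]: on [w_y^2] this gives [14 * e * N], on the other terms at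
    most [2 / N] times their constants. Thus [124 = 42 + 14 + 68]. *)
Lemma wnorm_srhs_le (N : nat) (e m delta : R) (w : nat -> trigpoly) (j : nat) :
  (0 < N)%nat -> 0 < e <= 1 -> 0 <= m <= 1 -> e * INR N <= delta -> / INR N <= delta ->
  sdegree 1 w j -> w (S j) = srhs N e m w j ->
  let a := wnorm w in
  let aa := PS_mult a a in
  a (S j) <= delta *
    (124 * aa j + 80 * a j + 28 * PS_mult aa a j + 6 * PS_mult aa aa j).
Proof.
  intros HN He Hm Hd1 Hd2 Hdeg Hw a aa.
  pose proof (tnorm_srem_le N e m w j (proj1 He) Hm) as HR. cbv zeta in HR. fold a aa in HR.
  assert (Ha : forall i, 0 <= a i).
  { intros i. unfold a, wnorm. pose proof (tnorm_nonneg (w i)).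
    pose proof (tnorm_nonneg (sderiv w i)). lra. }
  assert (Haa : forall i, 0 <= aa i) by (intros i; apply (PS_mult_le a a a a); intros; split; auto; lra).
  assert (H3 : 0 <= PS_mult aa a j) by (apply (PS_mult_le aa aa a a); intros; split; auto; lra).
  assert (H4 : 0 <= PS_mult aa aa j) by (apply (PS_mult_le aa aa aa aa); intros; split; auto; lra).
  specialize (Haa j). specialize (Ha j).
  assert (HWP : 0 <= tnorm (smul w (sderiv w) j) <= aa j).
  { rewrite tnorm_smul. apply PS_mult_le; intros i; unfold a, wnorm;
      pose proof (tnorm_nonneg (w i)); pose proof (tnorm_nonneg (sderiv w i)); lra. }
  assert (HN' : 0 < INR N) by (apply lt_0_INR; lia).
  unfold a at 1, wnorm, sderiv. rewrite Hw. unfold srhs.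
  assert (TD : forall c l, tnorm (tderiv (tscal c l)) = Rabs c * tnorm (tderiv l)).
  { intros c l. induction l as [|[[k phi] c'] l IH]; simpl; [ring|].
    fold (tscal c l) (tderiv (tscal c l)) (tderiv l). rewrite IH, !Rabs_mult. ring. }
  rewrite TD. unfold tderiv at 1. rewrite map_app. fold (tderiv (tscal (14 * e * INR N) (smul w (sderiv w) j))).
  fold (tderiv (tscal (/ e) (tdxLm2 N (srem N e m w j)))).
  rewrite !tnorm_tscal, !tnorm_app, !TD, !tnorm_tscal.
  pose proof (sdegree_smul _ _ _ _ _ Hdeg (sdegree_sderiv _ _ _ Hdeg)) as HdWP.
  pose proof (tnorm_tderiv _ _ (HdWP j (le_n _))) as HDWP.
  destruct (tnorm_tdxLm2 N (srem N e m w j) HN) as [HL1 HL2].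
  set (WP := tnorm (smul w (sderiv w) j)) in *.
  set (DWP := tnorm (tderiv (smul w (sderiv w) j))) in *.
  set (R0 := tnorm (srem N e m w j)) in *.
  set (L1 := tnorm (tdxLm2 N _)) in *. set (L2 := tnorm (tderiv (tdxLm2 N _))) in *.
  assert (Hie : 0 < / e) by (apply Rinv_0_lt_compat; lra).
  assert (HeN : 0 < e * INR N) by (apply Rmult_lt_0_compat; lra).
  rewrite (Rabs_pos_eq (14 * e * INR N)), (Rabs_pos_eq (/ e)) by lra.
  assert (HS : 0 < INR (S j)) by (apply lt_0_INR; lia).
  rewrite (Rabs_pos_eq (/ INR (S j))) by (left; apply Rinv_0_lt_compat, HS).
  rewrite <- Rmult_plus_distr_l.
  apply Rmult_le_reg_l with (INR (S j)); [exact HS|].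
  rewrite <- Rmult_assoc, Rinv_r, Rmult_1_l by lra.
  assert (HS1 : 1 <= INR (S j)) by (rewrite S_INR; pose proof (pos_INR j); lra).
  assert (ED : 1 + INR (3 * j + (1 + 1)) = 3 * INR (S j)).
  { rewrite plus_INR, mult_INR, (S_INR j). set (x := INR j). simpl. ring. }
  assert (B1 : 14 * e * INR N * WP + 14 * e * INR N * DWP <= INR (S j) * (42 * delta * aa j)).
  { apply Rle_trans with (14 * (e * INR N) * ((1 + INR (3 * j + (1 + 1))) * aa j)).
    - rewrite <- Rmult_plus_distr_l, Rmult_assoc, Rmult_assoc, Rmult_assoc.
      pose proof (pos_INR (3 * j + (1 + 1))). rewrite <- (Rmult_assoc e).
      apply Rmult_le_compat_l; [lra|]. apply Rmult_le_compat_l; [lra|]. nra.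
    - rewrite ED.
      replace (INR (S j) * (42 * delta * aa j)) with (14 * delta * (3 * INR (S j) * aa j)) by ring.
      apply Rmult_le_compat_r; [|lra]. apply Rmult_le_pos; lra. }
  assert (B2 : / e * L1 + / e * L2 <=
    delta * (82 * aa j + 80 * a j + 28 * PS_mult aa a j + 6 * PS_mult aa aa j)).
  { apply Rle_trans with (2 * / e * / INR N * R0).
    { assert (L1 + L2 <= 2 * (/ INR N * R0)) by lra.
      replace (2 * / e * / INR N * R0) with (/ e * (2 * (/ INR N * R0))) by ring. nra. }
    assert (HiN : 0 < / INR N) by (apply Rinv_0_lt_compat; lra).
    eapply Rle_trans; [apply Rmult_le_compat_l, HR; nra|].
    set (A := aa j) in *. set (X := a j) in *. set (U := PS_mult aa a j) in *.
    set (V := PS_mult aa aa j) in *. set (n := INR N) in *.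
    replace (2 * / e * / n * (7 * e ^ 2 * n ^ 2 * A + 40 * e * X + 34 * e ^ 2 * A +
      14 * e ^ 3 * U + 3 * e ^ 4 * V)) with
      (14 * (e * n * A) + / n * (80 * X + 68 * (e * A) + 28 * (e ^ 2 * U) + 6 * (e ^ 3 * V)))
      by (field; lra).
    assert (E1 : e * n * A <= delta * A) by (apply Rmult_le_compat_r; lra).
    assert (E2 : e * A <= A) by nra.
    assert (P2 : 0 < e ^ 2 <= 1) by nra. assert (P3 : 0 < e ^ 3 <= 1) by (simpl; nra).
    assert (E3 : e ^ 2 * U <= U) by nra.
    assert (E4 : e ^ 3 * V <= V) by nra.
    assert (E5 : / n * (80 * X + 68 * (e * A) + 28 * (e ^ 2 * U) + 6 * (e ^ 3 * V)) <=
      delta * (80 * X + 68 * A + 28 * U + 6 * V)).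
    { apply Rmult_le_compat; [lra| |lra|lra].
      assert (0 <= e * A) by nra. assert (0 <= e ^ 2 * U) by nra.
      assert (0 <= e ^ 3 * V) by nra. lra. }
    lra. }
  set (Q := delta * (82 * aa j + _ + _ + _)) in *.
  assert (0 <= Q).
  { unfold Q. apply Rmult_le_pos; [|lra]. lra. }
  replace (delta * (124 * aa j + 80 * a j + 28 * PS_mult aa a j + 6 * PS_mult aa aa j))
    with (42 * delta * aa j + Q) by (unfold Q; ring).
  nra.
Qed.

(** Multiplying the recursive bound [wnorm_srhs_le] by [2 ^ S j] and summing bounds each partial
    sum by a polynomial in the previous one, which closes the induction with the bound 3. *)
Lemma formal_solution (N : nat) (e m delta : R) :
  (0 < N)%nat -> 0 < e <= 1 -> 0 <= m <= 1 -> e * INR N <= delta -> / INR N <= delta ->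
  5196 * delta <= 1 ->
  exists w : nat -> trigpoly, w O = [(1%Z, 0, 1)] /\
    (forall j, w (S j) = srhs N e m w j) /\
    (forall j, degree_le (3 * j + 1) (w j)) /\
    (forall J, psum (wnorm w) J <= 2 + 5196 * delta).
Proof.
  intros HN He Hm Hd1 Hd2 Hd.
  destruct (causal_recursion [(1%Z, 0, 1)] (srhs N e m) (srhs_causal N e m)) as [w [W0 WS]].
  exists w. split; [exact W0|]. split; [exact WS|].
  assert (D : forall J, sdegree 1 w J).
  { induction J as [|J IH]; intros i Hi.
    - replace i with O by lia. rewrite W0. repeat constructor; simpl; lia.
    - destruct (Nat.eq_dec i (S J)) as [->|]; [|apply IH; lia].
      rewrite WS. apply sdegree_srhs, IH. }
  split; [intros j; now apply (D j)|].
  set (a := wnorm w). set (aa := PS_mult a a).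
  assert (Ha : forall i, 0 <= a i).
  { intros i. unfold a, wnorm. pose proof (tnorm_nonneg (w i)).
    pose proof (tnorm_nonneg (sderiv w i)). lra. }
  assert (Haa : forall i, 0 <= aa i).
  { intros i. apply (PS_mult_le a a a a); intros; split; auto; lra. }
  assert (Hdpos : 0 < delta).
  { eapply Rlt_le_trans; [|exact Hd2]. apply Rinv_0_lt_compat, lt_0_INR. lia. }
  assert (A0 : a O = 2).
  { unfold a, wnorm, sderiv. rewrite W0. simpl. rewrite Rmult_1_r, Rabs_R1. ring. }
  induction J as [|J IH]; [unfold psum; simpl; rewrite A0; lra|].
  (* The summand 2 is [a 0], the norm of the cosine plus that of its derivative; the factor 2 is
     left over from [2 ^ S j = 2 * 2 ^ j]. Together with 2598 below it gives 5196, and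
     [5196 * delta <= 1] keeps the bound at most 3. *)
  assert (Step : psum a (S J) <= 2 + 2 * delta *
    (124 * psum aa J + 80 * psum a J + 28 * psum (PS_mult aa a) J + 6 * psum (PS_mult aa aa) J)).
  { unfold psum at 1. rewrite decomp_sum by lia. simpl pred.
    rewrite A0, pow_O, Rmult_1_r. apply Rplus_le_compat_l.
    apply Rle_trans with (sum_f_R0 (fun i => 2 * delta * ((124 * aa i + 80 * a i +
      28 * PS_mult aa a i + 6 * PS_mult aa aa i) * 2 ^ i)) J).
    - apply sum_Rle. intros i _.
      pose proof (wnorm_srhs_le N e m delta w i HN He Hm Hd1 Hd2 (D i) (WS i)) as H.
      cbv zeta in H. fold a aa in H. simpl pow. assert (0 < 2 ^ i) by (apply pow_lt; lra).
      apply Rle_trans with (delta * (124 * aa i + 80 * a i + 28 * PS_mult aa a i +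
        6 * PS_mult aa aa i) * (2 * 2 ^ i)).
      + apply Rmult_le_compat_r; lra.
      + right; ring.
    - right. unfold psum. clear. induction J as [|J IH]; simpl; [ring|]. rewrite IH. ring. }
  eapply Rle_trans; [exact Step|].
  pose proof (psum_nonneg a J Ha) as S0. pose proof (psum_nonneg aa J Haa) as SS0.
  pose proof (psum_mult_le a a J Ha Ha) as M2. fold aa in M2.
  pose proof (psum_mult_le aa a J Haa Ha) as M3.
  pose proof (psum_mult_le aa aa J Haa Haa) as M4.
  set (s := psum a J) in *. set (s2 := psum aa J) in *.
  assert (Hs : s <= 3) by lra.
  assert (Hs2 : s2 <= 9) by nra.
  assert (H3 : psum (PS_mult aa a) J <= 27).
  { apply (Rle_trans _ _ _ M3). apply Rle_trans with (9 * 3); [apply Rmult_le_compat|]; lra. }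
  assert (H4 : psum (PS_mult aa aa) J <= 81).
  { apply (Rle_trans _ _ _ M4). apply Rle_trans with (9 * 9); [apply Rmult_le_compat|]; lra. }
  set (u := psum (PS_mult aa a) J) in *. set (v := psum (PS_mult aa aa) J) in *.
  (* [2598 = 124 * 9 + 80 * 3 + 28 * 27 + 6 * 81] *)
  assert (delta * (124 * s2 + 80 * s + 28 * u + 6 * v) <= delta * 2598); [|lra].
  apply Rmult_le_compat_l; lra.
Qed.

(** * Convergence of the power series *)

Lemma spectrum_const (N : nat) (m : R) : spectrum N 0 (fun _ => m).
Proof.
  assert (H : degree_le 0 [(0%Z, 0, m)]) by (repeat constructor; simpl; lia).
  generalize (ev_spectrum N 0 0 _ H). simpl.
  replace (fun x => m * cos (0 * (INR N * (x + 0)) + 0) + 0) with (fun _ : R => m); auto.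
  apply functional_extensionality; intros x.
  replace (0 * (INR N * (x + 0)) + 0) with 0 by ring. rewrite cos_0. ring.
Qed.

(** A constant is a family with [N = 1] whose terms vanish for [j >= 1], and [Rpower 1 r = 1]. *)
Lemma const_Hsum (r : R) : 0 <= r -> exists K, 0 < K /\ forall m : R,
  exists l, infinite_sum (Hterm r (fun _ => m)) l /\ 0 <= l <= K * m ^ 2.
Proof.
  intros Hr. destruct (family_Hsum r Hr) as [K [HK H]]. exists K. split; [exact HK|]. intros m.
  set (f := fun (j : nat) (_ : R) => match j with O => m | S _ => 0 end).
  assert (Hf : family 1 (Rabs m) f).
  { intros j. split.
    - destruct (spectrum_const 1 (f j 0)) as [C Z]. split; [destruct j; exact C|].
      intros k th Hk. destruct j; apply Z; intros [k' [E1 E2]]; apply Hk; exists k'; lia.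
    - intros x. pose proof (majorant_pos j) as P. pose proof (Rabs_pos m). destruct j; simpl.
      + unfold majorant. simpl. lra.
      + rewrite Rabs_R0. nra. }
  destruct (H 1%nat _ f ltac:(lia) (Rabs_pos m) Hf) as [l Hl]. exists l.
  replace (fun x => Series (fun j => f j x)) with (fun _ : R => m) in Hl.
  - assert (R1 : Rpower (INR 1) r = 1) by (unfold Rpower; simpl; now rewrite ln_1, Rmult_0_r, exp_0).
    rewrite R1, Rmult_1_l, pow2_abs in Hl. exact Hl.
  - apply functional_extensionality; intros x. symmetry.
    apply is_series_unique, is_series_Reals. intros eps Heps. exists O. intros n _.
    replace (sum_f_R0 (fun j => f j x) n) with m; [unfold Rdist; now rewrite Rminus_diag, Rabs_R0|].
    induction n as [|n IH]; simpl; [reflexivity|]. rewrite <- IH. ring.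
Qed.

Lemma increment_bound (f f1 : R -> R) (M t0 t : R) :
  (forall z, Rmin t0 t <= z <= Rmax t0 t -> is_derive f z (f1 z) /\ Rabs (f1 z) <= M) ->
  Rabs (f t - f t0) <= M * Rabs (t - t0).
Proof.
  intros H. destruct (MVT_gen f t0 t f1) as [c [Hc E]].
  - intros z Hz. apply H. lra.
  - intros z Hz. apply derivable_continuous_pt. exists (f1 z). apply is_derive_Reals, H, Hz.
  - rewrite E, Rabs_mult. apply Rmult_le_compat_r; [apply Rabs_pos|now apply H].
Qed.

(** The difference quotient is a value [f1 c], so the error is an increment of [f1], which [f2]
    controls. *)
Lemma quotient_bound (f f1 f2 : R -> R) (M t0 t : R) : t <> t0 ->
  (forall z, Rmin t0 t <= z <= Rmax t0 t ->
     is_derive f z (f1 z) /\ is_derive f1 z (f2 z) /\ Rabs (f2 z) <= M) ->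
  Rabs ((f t - f t0) / (t - t0) - f1 t0) <= M * Rabs (t - t0).
Proof.
  intros Ht H. destruct (MVT_gen f t0 t f1) as [c [Hc E]].
  - intros z Hz. apply H. lra.
  - intros z Hz. apply derivable_continuous_pt. exists (f1 z). apply is_derive_Reals, H, Hz.
  - rewrite E. replace (f1 c * (t - t0) / (t - t0) - f1 t0) with (f1 c - f1 t0) by (field; lra).
    apply Rle_trans with (M * Rabs (c - t0)).
    + apply (increment_bound f1 f2). intros z Hz.
      destruct (H z) as [_ [A B]]; [|auto].
      revert Hz Hc. unfold Rmin, Rmax. destruct (Rle_dec t0 t), (Rle_dec t0 c); lra.
    + apply Rmult_le_compat_l.
      * destruct (H c Hc) as [_ [_ B]]. eapply Rle_trans; [apply Rabs_pos|exact B].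
      * revert Hc. unfold Rmin, Rmax, Rabs.
        destruct (Rle_dec t0 t), (Rcase_abs (c - t0)), (Rcase_abs (t - t0)); lra.
Qed.

(** The second derivatives bound the error of the [j]-th difference quotient by [|h| * M j], and
    these errors can be summed. *)
Lemma Series_derivable (f f1 f2 : nat -> R -> R) (A B M : nat -> R) :
  (forall j x, is_derive (f j) x (f1 j x)) -> (forall j x, is_derive (f1 j) x (f2 j x)) ->
  (forall j x, Rabs (f j x) <= A j) -> (forall j x, Rabs (f1 j x) <= B j) ->
  (forall j x, Rabs (f2 j x) <= M j) -> ex_series A -> ex_series B -> ex_series M ->
  forall x, derivable_pt_lim (fun x => Series (fun j => f j x)) x (Series (fun j => f1 j x)).
Proof.
  intros H1 H2 HA HB HM EA EB EM x eps Heps.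
  assert (SM : 0 <= Series M).
  { apply Rle_trans with (Rabs (Series M)); [apply Rabs_pos|].
    apply Series_abs_le; [|exact EM]. intros j.
    rewrite Rabs_pos_eq; [lra|]. eapply Rle_trans; [apply Rabs_pos|apply (HM j 0)]. }
  assert (Hd : 0 < eps / (Series M + 1)) by (apply Rdiv_lt_0_compat; lra).
  exists (mkposreal _ Hd). intros h Hh Hlt. simpl in Hlt.
  assert (Ef : forall z, ex_series (fun j => f j z)) by (intros; apply (ex_series_abs_le _ A); auto).
  assert (Ef1 : ex_series (fun j => f1 j x)) by (apply (ex_series_abs_le _ B); auto).
  assert (E : (Series (fun j => f j (x + h)) - Series (fun j => f j x)) / h -
      Series (fun j => f1 j x) = Series (fun j => (f j (x + h) - f j x) / h - f1 j x)).
  { rewrite Series_minus; [| |exact Ef1].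
    2:{ apply (ex_series_scal_r (/ h) (fun j => f j (x + h) - f j x)).
        apply (ex_series_minus (V := R_NormedModule) (fun j => f j (x + h)) (fun j => f j x)); auto. }
    unfold Rdiv. rewrite Series_scal_r, Series_minus by auto. reflexivity. }
  rewrite E.
  apply Rle_lt_trans with (Series (fun j => Rabs h * M j)).
  - apply Series_abs_le; [|apply (ex_series_scal (V := R_NormedModule)), EM].
    intros j. pose proof (quotient_bound (f j) (f1 j) (f2 j) (M j) x (x + h)) as Q.
    replace (x + h - x) with h in Q by ring. rewrite (Rmult_comm (Rabs h)).
    apply Q; auto. lra.
  - rewrite Series_scal_l. apply Rle_lt_trans with (Rabs h * (Series M + 1)).
    + apply Rmult_le_compat_l; [apply Rabs_pos|lra].
    + apply Rlt_div_r; lra.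
Qed.

Definition bounded_psum (a : nat -> trigpoly) (K : R) : Prop :=
  forall J, psum (fun j => tnorm (a j)) J <= K.

Lemma bounded_psum_tnorm (a : nat -> trigpoly) (K : R) (j : nat) :
  bounded_psum a K -> tnorm (a j) <= K * (1 / 2) ^ j.
Proof.
  intros H.
  assert (A : tnorm (a j) * 2 ^ j <= K).
  { eapply Rle_trans; [|apply (H j)]. unfold psum. destruct j as [|j]; simpl; [lra|].
    assert (0 <= psum (fun j => tnorm (a j)) j) by (apply psum_nonneg; intros; apply tnorm_nonneg).
    unfold psum in *. lra. }
  assert (P : 0 < 2 ^ j) by (apply pow_lt; lra).
  unfold Rdiv. rewrite Rmult_1_l, pow_inv. apply Rle_div_r; lra.
Qed.

Lemma bounded_psum_smul (a b : nat -> trigpoly) (K L : R) :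
  bounded_psum a K -> bounded_psum b L -> bounded_psum (smul a b) (K * L).
Proof.
  intros Ha Hb J.
  replace (fun j => tnorm (smul a b j)) with
    (PS_mult (fun j => tnorm (a j)) (fun j => tnorm (b j)))
    by (apply functional_extensionality; intros j; now rewrite tnorm_smul).
  assert (P : forall c J, 0 <= psum (fun j => tnorm (c j)) J).
  { intros c J'. apply psum_nonneg. intros. apply tnorm_nonneg. }
  eapply Rle_trans; [apply psum_mult_le; intros; apply tnorm_nonneg|].
  apply Rmult_le_compat; auto.
Qed.

Lemma ex_series_geom_half (K : R) : ex_series (fun j => K * (1 / 2) ^ j).
Proof.
  apply (ex_series_scal (V := R_NormedModule)), ex_series_geom.
  rewrite Rabs_pos_eq; lra.
Qed.

Lemma bounded_psum_radius (a : nat -> trigpoly) (K t y : R) : bounded_psum a K -> Rabs t <= 1 ->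
  Rbar_lt (Rabs t) (CV_radius (fun j => ev (a j) y)).
Proof.
  intros H Ht. apply Rbar_lt_le_trans with (Finite 2); [simpl; lra|].
  apply (proj1 (CV_radius_bounded _)). exists K. intros n.
  rewrite Rabs_mult, (Rabs_pos_eq (2 ^ n)) by (apply pow_le; lra).
  pose proof (bounded_psum_tnorm a K n H) as B. pose proof (ev_bound (a n) y).
  assert (P : 0 < 2 ^ n) by (apply pow_lt; lra).
  unfold Rdiv in B. rewrite Rmult_1_l, pow_inv in B. apply Rle_div_r in B; [|exact P].
  nra.
Qed.

Lemma bounded_psum_ex_pseries (a : nat -> trigpoly) (K t y : R) :
  bounded_psum a K -> Rabs t <= 1 -> ex_series (fun j => ev (a j) y * t ^ j).
Proof.
  intros H Ht.
  apply (ex_series_ext (fun j => scal (pow_n t j) (ev (a j) y))).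
  - intros n. rewrite pow_n_pow. unfold scal; simpl; unfold Hierarchy.mult; simpl. ring.
  - apply (CV_radius_inside (fun j => ev (a j) y) t), (bounded_psum_radius a K t y H Ht).
Qed.

Lemma PSeries_smul (a b : nat -> trigpoly) (K L t y : R) :
  bounded_psum a K -> bounded_psum b L -> Rabs t <= 1 ->
  PSeries (fun j => ev (smul a b j) y) t =
  PSeries (fun j => ev (a j) y) t * PSeries (fun j => ev (b j) y) t.
Proof.
  intros Ha Hb Ht.
  rewrite <- PSeries_mult by (eapply bounded_psum_radius; eauto).
  apply PSeries_ext. intros j. apply ev_smul.
Qed.

Lemma pow_le_1 (t : R) (j : nat) : Rabs t <= 1 -> Rabs (t ^ j) <= 1.
Proof.
  intros Ht. rewrite <- RPow_abs, <- (pow1 j). apply pow_incr. split; [apply Rabs_pos|auto].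
Qed.

Lemma bounded_psum_wnorm (w : nat -> trigpoly) (K : R) :
  (forall J, psum (wnorm w) J <= K) -> bounded_psum w K /\ bounded_psum (sderiv w) K.
Proof.
  intros H. split; intros J; (eapply Rle_trans; [|apply (H J)]); apply sum_Rle; intros j _;
    (apply Rmult_le_compat_r; [apply pow_le; lra|]); unfold wnorm;
    pose proof (tnorm_nonneg (w j)); pose proof (tnorm_nonneg (sderiv w j)); lra.
Qed.

(** [K'] may depend on [N], [e] and [m]: it only serves the convergence of the nonlocal term, while
    the uniform estimates concern [w]. *)
Lemma bounded_psum_srem (N : nat) (e m K : R) (w : nat -> trigpoly) :
  bounded_psum w K -> bounded_psum (sderiv w) K -> exists K', bounded_psum (srem N e m w) K'.
Proof.
  intros Hw Hp.
  assert (A : forall a b K L, bounded_psum a K -> bounded_psum b L ->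
    bounded_psum (fun j => a j ++ b j) (K + L)).
  { intros a b K0 L Ha Hb J. specialize (Ha J). specialize (Hb J). unfold psum in *.
    eapply Rle_trans; [|apply Rplus_le_compat; [exact Ha|exact Hb]]. right.
    rewrite <- sum_plus. apply sum_eq. intros j _. rewrite tnorm_app. ring. }
  assert (B : forall c a K, bounded_psum a K ->
    bounded_psum (fun j => tscal c (a j)) (Rabs c * K)).
  { intros c a K0 Ha J. specialize (Ha J). unfold psum in *.
    apply Rle_trans with (Rabs c * sum_f_R0 (fun j => tnorm (a j) * 2 ^ j) J).
    - right. rewrite scal_sum. apply sum_eq. intros j _. rewrite tnorm_tscal. ring.
    - apply Rmult_le_compat_l; [apply Rabs_pos|exact Ha]. }
  pose proof (bounded_psum_smul _ _ _ _ Hw Hw) as H2.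
  eexists. unfold srem.
  repeat (apply A); apply B;
    repeat (first [eassumption | eapply bounded_psum_smul]).
Qed.

Lemma PSeries_srem (N : nat) (e m K t y : R) (w : nat -> trigpoly) :
  bounded_psum w K -> bounded_psum (sderiv w) K -> Rabs t <= 1 ->
  let W := PSeries (fun j => ev (w j) y) t in
  let P := PSeries (fun j => ev (sderiv w j) y) t in
  Rnl (m + e * W) (e * INR N * P) =
    Rnl m 0 + PSeries (fun j => ev (srem N e m w j) y) t.
Proof.
  intros Hw Hp Ht W P.
  pose proof (bounded_psum_smul _ _ _ _ Hw Hw) as H2.
  pose proof (bounded_psum_smul _ _ _ _ Hp Hp) as HD2.
  pose proof (bounded_psum_smul _ _ _ _ H2 Hw) as H3.
  pose proof (bounded_psum_smul _ _ _ _ H2 H2) as H4.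
  assert (E : PSeries (fun j => ev (srem N e m w j) y) t =
    7 * e ^ 2 * INR N ^ 2 * (P * P) +
    ((-12 * m ^ 3 + 6 * m ^ 2 - 20 * m - 2) * e * W +
    ((-18 * m ^ 2 + 6 * m - 10) * e ^ 2 * (W * W) +
    ((-12 * m + 2) * e ^ 3 * (W * W * W) +
    -3 * e ^ 4 * (W * W * (W * W)))))).
  { unfold W, P.
    rewrite <- !(PSeries_smul _ _ _ _ t y Hw Hw Ht), <- !(PSeries_smul _ _ _ _ t y Hp Hp Ht).
    rewrite <- !(PSeries_smul _ _ _ _ t y H2 Hw Ht), <- !(PSeries_smul _ _ _ _ t y H2 H2 Ht).
    apply is_series_unique.
    pose proof (Series_correct _ (bounded_psum_ex_pseries _ _ t y Hw Ht)) as S1.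
    pose proof (Series_correct _ (bounded_psum_ex_pseries _ _ t y H2 Ht)) as S2.
    pose proof (Series_correct _ (bounded_psum_ex_pseries _ _ t y HD2 Ht)) as SD2.
    pose proof (Series_correct _ (bounded_psum_ex_pseries _ _ t y H3 Ht)) as S3.
    pose proof (Series_correct _ (bounded_psum_ex_pseries _ _ t y H4 Ht)) as S4.
    assert (Sc : forall (c : R) a l, is_series (fun j => ev (a j) y * t ^ j) l ->
      is_series (fun j => ev (tscal c (a j)) y * t ^ j) (c * l)).
    { intros c a l Hl. apply (is_series_ext (fun j => scal c (ev (a j) y * t ^ j))).
      - intros n. rewrite ev_tscal. unfold scal; simpl; unfold Hierarchy.mult; simpl. ring.
      - apply (is_series_scal (V := R_NormedModule)), Hl. }
    assert (Ad : forall a b l l', is_series (fun j => ev (a j) y * t ^ j) l ->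
      is_series (fun j => ev (b j) y * t ^ j) l' ->
      is_series (fun j => ev (a j ++ b j) y * t ^ j) (l + l')).
    { intros a b l l' Hl Hl'.
      apply (is_series_ext (fun j => plus (ev (a j) y * t ^ j) (ev (b j) y * t ^ j))).
      - intros n. rewrite ev_app. unfold plus; simpl. ring.
      - apply (is_series_plus (V := R_NormedModule)); assumption. }
    unfold srem. repeat (apply Ad); apply Sc; assumption. }
  rewrite E. unfold Rnl. ring.
Qed.

Lemma fcoef_opp_PI (f : R -> R) (k : Z) : continuity f -> fcoef f k (- (PI / 2) - PI / 2) = - fcoef f k 0.
Proof.
  intros Hf. apply is_RInt_fcoef_eq.
  apply (is_RInt_ext (fun x => opp (f x * cos (IZR k * x + 0)))).
  - intros x _. unfold opp; simpl.
    replace (IZR k * x + (- (PI / 2) - PI / 2)) with (- (PI - (IZR k * x + 0))) by field.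
    rewrite cos_neg, Rtrigo_facts.cos_pi_minus. ring.
  - apply (is_RInt_opp (V := R_NormedModule)), is_RInt_fcoef, Hf.
Qed.

Lemma mult_fcoef_const (m : R) (k : Z) (th : R) : mult k * fcoef (fun _ => m) k th = 0.
Proof.
  destruct (Z.eq_dec k 0) as [->|Hk]; [unfold mult; simpl; field|].
  rewrite (proj2 (spectrum_const 1 m)); [ring|]. intros [k' [E1 E2]]. lia.
Qed.

(** Fourier coefficients commute with uniformly convergent sums, so the multiplier may act term by
    term. The constant [kappa] has only the frequency 0, where the symbol vanishes. *)
Lemma is_dxLm2_series (N : nat) (a : nat -> trigpoly) (K kappa t b : R) :
  (0 < N)%nat -> bounded_psum a K -> Rabs t <= 1 ->
  is_dxLm2 (fun x => kappa + PSeries (fun j => ev (a j) (INR N * (x + b))) t)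
    (fun x => PSeries (fun j => ev (tdxLm2 N (a j)) (INR N * (x + b))) t).
Proof.
  intros HN Ha Ht.
  set (f := fun j x => ev (a j) (INR N * (x + b)) * t ^ j).
  set (g := fun j x => ev (tdxLm2 N (a j)) (INR N * (x + b)) * t ^ j).
  assert (Cont : forall l j, continuity (fun x => ev l (INR N * (x + b)) * t ^ j)).
  { intros l j. apply (continuity_mult (fun x => ev l _) (fun _ => t ^ j)).
    - apply ev_continuity.
    - apply continuity_const. now intros x y. }
  assert (Bd : forall l j x, Rabs (ev l (INR N * (x + b)) * t ^ j) <= tnorm l).
  { intros l j x. rewrite Rabs_mult. pose proof (ev_bound l (INR N * (x + b))).
    pose proof (Rabs_pos (ev l (INR N * (x + b)))). pose proof (pow_le_1 t j Ht).
    pose proof (Rabs_pos (t ^ j)). nra. }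
  assert (HN1 : 1 <= INR N) by (apply (le_INR 1); lia).
  assert (Cf : forall j, continuity (f j)) by (intros; apply Cont).
  assert (Cg : forall j, continuity (g j)) by (intros; apply Cont).
  assert (Bf : forall j x, Rabs (f j x) <= K * (1 / 2) ^ j).
  { intros j x. eapply Rle_trans; [apply Bd|]. now apply bounded_psum_tnorm. }
  assert (Bg : forall j x, Rabs (g j x) <= K * (1 / 2) ^ j).
  { intros j x. eapply Rle_trans; [apply Bd|].
    eapply Rle_trans; [|apply (bounded_psum_tnorm a K j Ha)].
    eapply Rle_trans; [apply tnorm_tdxLm2, HN|]. pose proof (tnorm_nonneg (a j)).
    assert (/ INR N <= 1); [|nra]. rewrite <- Rinv_1. apply Rinv_le_contravar; lra. }
  pose proof (ex_series_geom_half K) as EK.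
  pose proof (Series_continuity f _ Cf Bf EK) as CF.
  pose proof (Series_continuity g _ Cg Bg EK) as CG.
  set (F := fun x => Series (fun j => f j x)) in *.
  set (G := fun x => Series (fun j => g j x)) in *.
  change (is_dxLm2 (fun x => kappa + F x) G).
  assert (Key : forall k th, fcoef G k th = mult k * fcoef (fun x => kappa + F x) k (th - PI / 2)).
  { intros k th.
    replace (fun x => kappa + F x) with (fun x => 1 * kappa + 1 * F x)
      by (apply functional_extensionality; intros; ring).
    rewrite (fcoef_lin 1 1 (fun _ => kappa)); [|apply continuity_const; now intros x y|exact CF].
    rewrite Rmult_plus_distr_l, !Rmult_1_l, mult_fcoef_const, Rplus_0_l.
    unfold F, G.
    rewrite <- (is_series_unique _ _ (fcoef_Series f _ k (th - PI / 2) Cf Bf EK)).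
    rewrite <- (is_series_unique _ _ (fcoef_Series g _ k th Cg Bg EK)).
    rewrite <- Series_scal_l. apply Series_ext. intros j. unfold f, g.
    assert (P : forall l th, fcoef (fun x => ev l (INR N * (x + b)) * t ^ j) k th =
      t ^ j * fcoef (fun x => ev l (INR N * (x + b))) k th).
    { intros l th'. set (h := fun x => ev l (INR N * (x + b))).
      transitivity (fcoef (fun x => t ^ j * h x + 0 * h x) k th').
      - f_equal. apply functional_extensionality; intros x. unfold h. ring.
      - rewrite fcoef_lin by apply ev_continuity. fold h. ring. }
    rewrite !P, ev_tdxLm2_coef. ring. }
  assert (CkF : continuity (fun x => kappa + F x)).
  { apply (continuity_plus (fun _ => kappa) F); [apply continuity_const; now intros x y|exact CF]. }
  split; [|split; [exact CG|]].
  - intros x. unfold G. apply Series_ext. intros j. unfold g. f_equal. apply ev_periodic.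
  - intros k. rewrite !Ck_fcoef, !Sk_fcoef, !Key. rewrite fcoef_opp_PI by exact CkF.
    split; [do 2 f_equal; ring | ring].
Qed.

(** * Dependence on time in Sobolev norms *)

(** For [r = s] and [e = N^(-s)] the factor [|e| * N^r] is 1, which makes the H^s bound of the waves
    independent of [N]. *)
Lemma affine_Hnorm (r : R) : 0 <= r -> exists K, 0 < K /\ forall N eta f m e,
  (0 < N)%nat -> 0 <= eta -> family N eta f ->
  (exists l, infinite_sum (Hterm r (fun x => m + e * Series (fun j => f j x))) l) /\
  Hnorm r (fun x => m + e * Series (fun j => f j x)) <=
    K * (Rabs m + Rabs e * Rpower (INR N) r * eta).
Proof.
  intros Hr. destruct (family_Hsum r Hr) as [K1 [HK1 H1]].
  destruct (const_Hsum r Hr) as [K2 [HK2 H2]].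
  exists (sqrt (2 * K1 + 2 * K2)). split; [apply sqrt_lt_R0; lra|].
  intros N eta f m e HN Heta Hf.
  destruct (H1 N eta f HN Heta Hf) as [l1 [S1 B1]]. destruct (H2 m) as [l2 [S2 B2]].
  destruct (Hsum_lin r 1 e l2 l1 (fun _ => m) (fun x => Series (fun j => f j x))) as [l [S B]]; auto.
  { apply continuity_const; now intros x y. }
  { apply (family_continuity N eta), Hf. }
  replace (fun x => 1 * m + e * Series (fun j => f j x)) with
    (fun x => m + e * Series (fun j => f j x)) in S
    by (apply functional_extensionality; intros x; ring).
  split; [now exists l|].
  unfold Hnorm. rewrite (Hsq_eq _ _ _ S).
  set (n := Rpower (INR N) r) in *.
  assert (Hn : 0 < n) by apply exp_pos.
  pose proof (Rabs_pos m) as Pm. pose proof (Rabs_pos e) as Pe.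
  assert (P : 0 <= Rabs e * n * eta) by (repeat apply Rmult_le_pos; lra).
  rewrite <- (sqrt_pow2 (Rabs m + Rabs e * n * eta)), <- sqrt_mult by nra.
  apply sqrt_le_1; [lra|apply Rmult_le_pos; nra|].
  apply Rle_trans with (2 * K2 * Rabs m ^ 2 + 2 * K1 * (Rabs e * n * eta) ^ 2).
  - replace ((Rabs e * n * eta) ^ 2) with (e ^ 2 * (n * eta) ^ 2) by (rewrite <- (pow2_abs e); ring).
    rewrite pow2_abs. pose proof (pow2_ge_0 e). nra.
  - set (X := Rabs m) in *. set (Y := Rabs e * n * eta) in *.
    assert (0 <= X * Y) by nra. nra.
Qed.

(** Lipschitz continuity in time. The constant may grow with [N], because continuity is a statement
    about each solution separately. *)
Lemma Hcont_family (r e m Q : R) (N : nat) (f : nat -> R -> R -> R) :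
  0 <= r -> (0 < N)%nat -> 0 <= Q ->
  (forall t x, 0 <= t <= 1 -> ex_series (fun j => f j t x)) ->
  (forall t t0, 0 <= t <= 1 -> 0 <= t0 <= 1 ->
     family N (Q * Rabs (t - t0)) (fun j x => f j t x - f j t0 x)) ->
  Hcont r 1 (fun t x => m + e * Series (fun j => f j t x)).
Proof.
  intros Hr HN HQ Hex Hf t0 Ht0 eps Heps.
  destruct (affine_Hnorm r Hr) as [K [HK H]].
  set (L := K * (Rabs e * Rpower (INR N) r * Q)).
  assert (HL : 0 <= L).
  { apply Rmult_le_pos; [lra|]. repeat apply Rmult_le_pos; auto.
    - apply Rabs_pos.
    - left; apply exp_pos. }
  exists (eps / (L + 1)). split; [apply Rdiv_lt_0_compat; lra|]. intros t Ht Hlt.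
  replace (fun x => m + e * Series (fun j => f j t x) - (m + e * Series (fun j => f j t0 x)))
    with (fun x => 0 + e * Series (fun j => f j t x - f j t0 x)).
  2:{ apply functional_extensionality; intros x. rewrite Series_minus by auto. ring. }
  pose proof (Rabs_pos (t - t0)) as Pt.
  destruct (H N (Q * Rabs (t - t0)) (fun j x => f j t x - f j t0 x) 0 e HN) as [_ B]; auto.
  { apply Rmult_le_pos; lra. }
  eapply Rle_lt_trans; [exact B|].
  replace (K * (Rabs 0 + Rabs e * Rpower (INR N) r * (Q * Rabs (t - t0))))
    with (L * Rabs (t - t0)) by (rewrite Rabs_R0; unfold L; ring).
  apply Rle_lt_trans with (Rabs (t - t0) * (L + 1)); [nra|]. apply Rlt_div_r; lra.
Qed.

Lemma Hderiv_family (r e m Q : R) (N : nat) (f f1 : nat -> R -> R -> R) :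
  0 <= r -> (0 < N)%nat -> 0 <= Q ->
  (forall t x, 0 <= t <= 1 -> ex_series (fun j => f j t x)) ->
  (forall t x, 0 <= t <= 1 -> ex_series (fun j => f1 j t x)) ->
  (forall t t0, 0 <= t <= 1 -> 0 <= t0 <= 1 -> t <> t0 ->
     family N (Q * Rabs (t - t0)) (fun j x => (f j t x - f j t0 x) / (t - t0) - f1 j t0 x)) ->
  Hderiv r 1 (fun t x => m + e * Series (fun j => f j t x))
    (fun t x => 0 + e * Series (fun j => f1 j t x)).
Proof.
  intros Hr HN HQ Hex Hex1 Hf t0 Ht0 eps Heps.
  destruct (affine_Hnorm r Hr) as [K [HK H]].
  set (L := K * (Rabs e * Rpower (INR N) r * Q)).
  assert (HL : 0 <= L).
  { apply Rmult_le_pos; [lra|]. repeat apply Rmult_le_pos; auto.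
    - apply Rabs_pos.
    - left; apply exp_pos. }
  exists (eps / (L + 1)). split; [apply Rdiv_lt_0_compat; lra|]. intros t Ht Hne Hlt.
  replace (fun x => (m + e * Series (fun j => f j t x) - (m + e * Series (fun j => f j t0 x))) /
      (t - t0) - (0 + e * Series (fun j => f1 j t0 x)))
    with (fun x => 0 + e * Series (fun j => (f j t x - f j t0 x) / (t - t0) - f1 j t0 x)).
  2:{ apply functional_extensionality; intros x. rewrite Series_minus; auto.
      - unfold Rdiv. rewrite Series_scal_r, Series_minus by auto. ring.
      - apply (ex_series_scal_r (/ (t - t0)) (fun j => f j t x - f j t0 x)).
        apply (ex_series_minus (V := R_NormedModule) (fun j => f j t x) (fun j => f j t0 x)); auto. }
  pose proof (Rabs_pos (t - t0)) as Pt.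
  destruct (H N (Q * Rabs (t - t0))
    (fun j x => (f j t x - f j t0 x) / (t - t0) - f1 j t0 x) 0 e HN) as [_ B]; auto.
  { apply Rmult_le_pos; lra. }
  eapply Rle_lt_trans; [exact B|].
  replace (K * (Rabs 0 + Rabs e * Rpower (INR N) r * (Q * Rabs (t - t0))))
    with (L * Rabs (t - t0)) by (rewrite Rabs_R0; unfold L; ring).
  apply Rle_lt_trans with (Rabs (t - t0) * (L + 1)); [nra|]. apply Rlt_div_r; lra.
Qed.

(** * The terms of the travelling series and their time derivatives *)

Definition term (N : nat) (c : R) (w : nat -> trigpoly) (j : nat) (t x : R) : R :=
  ev (w j) (INR N * (x + c * t)) * t ^ j.

Definition term_t (N : nat) (c : R) (w : nat -> trigpoly) (j : nat) (t x : R) : R :=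
  INR j * t ^ pred j * ev (w j) (INR N * (x + c * t)) +
  INR N * c * t ^ j * ev (sderiv w j) (INR N * (x + c * t)).

(** Where a truncated predecessor yields a wrong exponent, its factor [INR j] or [INR (pred j)]
    vanishes. *)
Definition term_tt (N : nat) (c : R) (w : nat -> trigpoly) (j : nat) (t x : R) : R :=
  INR j * (INR (pred j) * t ^ pred (pred j)) * ev (w j) (INR N * (x + c * t)) +
  2 * (INR N * c * (INR j * t ^ pred j)) * ev (sderiv w j) (INR N * (x + c * t)) +
  (INR N * c) ^ 2 * t ^ j * ev (sderiv (sderiv w) j) (INR N * (x + c * t)).

Lemma term_is_derive (N : nat) (c : R) (w : nat -> trigpoly) (j : nat) (t x : R) :
  is_derive (fun t => term N c w j t x) t (term_t N c w j t x).
Proof.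
  unfold term, term_t. auto_derive.
  - eexists. apply ev_derive.
  - rewrite (is_derive_unique _ _ _ (ev_derive _ _)). unfold sderiv. ring.
Qed.

Lemma term_t_is_derive (N : nat) (c : R) (w : nat -> trigpoly) (j : nat) (t x : R) :
  is_derive (fun t => term_t N c w j t x) t (term_tt N c w j t x).
Proof.
  unfold term_t, term_tt. auto_derive.
  - repeat split; eexists; apply ev_derive.
  - rewrite !(is_derive_unique _ _ _ (ev_derive _ _)). unfold sderiv. ring.
Qed.

Lemma term_spectrum (N : nat) (c : R) (w : nat -> trigpoly) (j : nat) (t : R) :
  degree_le (3 * j + 1) (w j) ->
  spectrum N (3 * j + 1) (term N c w j t) /\ spectrum N (3 * j + 1) (term_t N c w j t).
Proof.
  intros H. pose proof (ev_spectrum N _ (c * t) _ H) as H0.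
  pose proof (ev_spectrum N _ (c * t) _ (degree_le_tderiv _ _ H)) as H1.
  split; [|exact (spectrum_lin N _ _ _ _ _ H0 H1)].
  replace (term N c w j t) with (fun x => t ^ j * ev (w j) (INR N * (x + c * t)) +
    0 * ev (w j) (INR N * (x + c * t))).
  - now apply spectrum_lin.
  - apply functional_extensionality; intros x. unfold term. ring.
Qed.

Lemma Rabs_mult_le (a b A B : R) : Rabs a <= A -> Rabs b <= B -> Rabs (a * b) <= A * B.
Proof. intros. rewrite Rabs_mult. apply Rmult_le_compat; auto; apply Rabs_pos. Qed.

Lemma Rabs_plus_le (a b A B : R) : Rabs a <= A -> Rabs b <= B -> Rabs (a + b) <= A + B.
Proof. intros. eapply Rle_trans; [apply Rabs_triang|]. lra. Qed.

Lemma Rabs_pos_le (a A : R) : 0 <= a -> a <= A -> Rabs a <= A.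
Proof. intros. now rewrite Rabs_pos_eq. Qed.

(** Put [k = N * c] and [d = 3 * j + 1]. A time derivative costs [j] from the power of [t] and
    [k * d] from the phase, hence two cost [(j + k * d) ^ 2]. Both [j + k * d <= (1 + k) * d] and
    [d <= 3 * (j + 1)] lead to the 9 in [Q]. *)
Lemma term_bound (N : nat) (c K t x : R) (w : nat -> trigpoly) (j : nat) :
  0 <= c -> 0 <= K -> degree_le (3 * j + 1) (w j) -> tnorm (w j) <= K * (1 / 2) ^ j -> 0 <= t <= 1 ->
  let Q := 9 * K * (1 + INR N * c) ^ 2 in
  Rabs (term N c w j t x) <= K * (1 / 2) ^ j /\
  Rabs (term_t N c w j t x) <= Q * majorant j /\
  Rabs (term_tt N c w j t x) <= Q * majorant j.
Proof.
  intros Hc HK Hdeg HB Ht Q.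
  set (k := INR N * c) in *.
  assert (Hk : 0 <= k) by (apply Rmult_le_pos; [apply pos_INR|exact Hc]).
  set (d := INR (3 * j + 1)).
  set (y := INR N * (x + c * t)).
  set (b := tnorm (w j)) in *.
  assert (Hb : 0 <= b) by apply tnorm_nonneg.
  pose proof (tnorm_tderiv _ _ Hdeg) as P1. fold d b in P1.
  pose proof (tnorm_tderiv _ _ (degree_le_tderiv _ _ Hdeg)) as P2. fold d in P2.
  assert (Hd : d = 3 * INR j + 1).
  { unfold d. rewrite plus_INR, mult_INR. simpl. ring. }
  pose proof (pos_INR j) as Hj.
  assert (E0 : Rabs (ev (w j) y) <= b) by apply ev_bound.
  assert (E1 : Rabs (ev (sderiv w j) y) <= d * b) by (eapply Rle_trans; [apply ev_bound|exact P1]).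
  assert (E2 : Rabs (ev (sderiv (sderiv w) j) y) <= d * (d * b)).
  { eapply Rle_trans; [apply ev_bound|]. eapply Rle_trans; [exact P2|].
    apply Rmult_le_compat_l; [lra|exact P1]. }
  assert (Tp : forall i, Rabs (t ^ i) <= 1) by (intros i; apply pow_le_1, Rabs_le; lra).
  assert (Tj : forall i i', Rabs (INR i * t ^ i') <= INR i * 1).
  { intros i i'. apply Rabs_mult_le; [|apply Tp]. rewrite Rabs_pos_eq; [lra|apply pos_INR]. }
  assert (Hpj : INR (pred j) <= INR j) by (apply le_INR; lia).
  assert (M : ((1 + k) * d) ^ 2 * b <= Q * majorant j).
  { unfold Q, majorant.
    replace (9 * K * (1 + k) ^ 2 * ((INR j + 1) ^ 2 * (1 / 2) ^ j)) with
      (((1 + k) * (3 * (INR j + 1))) ^ 2 * (K * (1 / 2) ^ j)) by ring.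
    apply Rmult_le_compat; auto.
    - apply pow2_ge_0.
    - apply pow_incr. split; [apply Rmult_le_pos; lra|]. apply Rmult_le_compat_l; lra. }
  assert (Hkd : 1 <= (1 + k) * d) by nra.
  assert (F0 : Rabs (term N c w j t x) <= b).
  { unfold term. rewrite <- (Rmult_1_r b). now apply Rabs_mult_le. }
  assert (F1 : Rabs (term_t N c w j t x) <= INR j * 1 * b + k * 1 * (d * b)).
  { unfold term_t. fold k y. apply Rabs_plus_le; apply Rabs_mult_le; auto.
    apply Rabs_mult_le; auto. apply Rabs_pos_le; lra. }
  assert (F2 : Rabs (term_tt N c w j t x) <=
    INR j * (INR j * 1) * b + 2 * (k * (INR j * 1)) * (d * b) + k ^ 2 * 1 * (d * (d * b))).
  { unfold term_tt. fold k y. apply Rabs_plus_le; [apply Rabs_plus_le|]; apply Rabs_mult_le; auto.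
    - apply Rabs_mult_le; [apply Rabs_pos_le; lra|]. eapply Rle_trans; [apply Tj|]. lra.
    - apply Rabs_mult_le; [apply Rabs_pos_le; lra|]. apply Rabs_mult_le; auto.
      apply Rabs_pos_le; lra.
    - apply Rabs_mult_le; auto. apply Rabs_pos_le; [apply pow2_ge_0|lra]. }
  assert (G : forall X, X <= ((1 + k) * d) ^ 2 -> X * b <= Q * majorant j).
  { intros X HX. eapply Rle_trans; [|exact M]. apply Rmult_le_compat_r; auto. }
  split; [lra|]. split.
  - eapply Rle_trans; [exact F1|].
    replace (INR j * 1 * b + k * 1 * (d * b)) with ((INR j + k * d) * b) by ring.
    apply G. apply Rle_trans with ((1 + k) * d); nra.
  - eapply Rle_trans; [exact F2|].
    replace (INR j * (INR j * 1) * b + 2 * (k * (INR j * 1)) * (d * b) + k ^ 2 * 1 * (d * (d * b)))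
      with ((INR j + k * d) ^ 2 * b) by ring.
    apply G. apply pow_incr. split; [|lra].
    pose proof (Rmult_le_pos k d Hk). nra.
Qed.

(** * The exact solutions *)

Lemma majorant_ge_geom (j : nat) : (1 / 2) ^ j <= majorant j.
Proof.
  unfold majorant. pose proof (pos_INR j). assert (0 < (1 / 2) ^ j) by (apply pow_lt; lra).
  assert (1 <= (INR j + 1) ^ 2) by nra. nra.
Qed.

(** At fixed times the differences are linear combinations of terms, so they keep the spectrum, and
    the mean value theorem at each [x] gives their sup bounds. Hence differentiability in time with
    values in Sobolev spaces follows from pointwise estimates. *)
Lemma term_families (N : nat) (c : R) (w : nat -> trigpoly) :
  0 <= c -> (forall j, degree_le (3 * j + 1) (w j)) -> bounded_psum w 3 ->
  exists Q, 0 <= Q /\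
  (forall t, 0 <= t <= 1 ->
     family N 3 (fun j => term N c w j t) /\ family N Q (fun j => term_t N c w j t)) /\
  (forall t t0, 0 <= t <= 1 -> 0 <= t0 <= 1 ->
     family N (Q * Rabs (t - t0)) (fun j x => term N c w j t x - term N c w j t0 x) /\
     family N (Q * Rabs (t - t0)) (fun j x => term_t N c w j t x - term_t N c w j t0 x) /\
     (t <> t0 -> family N (Q * Rabs (t - t0)) (fun j x =>
        (term N c w j t x - term N c w j t0 x) / (t - t0) - term_t N c w j t0 x))).
Proof.
  intros Hc Hdeg Hw.
  set (Q := 9 * 3 * (1 + INR N * c) ^ 2). exists Q.
  assert (HQ : 0 <= Q) by (unfold Q; pose proof (pow2_ge_0 (1 + INR N * c)); lra).
  assert (B : forall j t x, 0 <= t <= 1 -> Rabs (term N c w j t x) <= 3 * (1 / 2) ^ j /\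
    Rabs (term_t N c w j t x) <= Q * majorant j /\
    Rabs (term_tt N c w j t x) <= Q * majorant j).
  { intros j t x Ht. apply term_bound; auto; [lra|]. now apply bounded_psum_tnorm. }
  assert (Sub : forall j f g, spectrum N (3 * j + 1) f -> spectrum N (3 * j + 1) g ->
    spectrum N (3 * j + 1) (fun x => f x - g x)).
  { intros j f g Hf Hg. pose proof (spectrum_lin _ _ 1 (-1) _ _ Hf Hg) as H.
    replace (fun x => f x - g x) with (fun x => 1 * f x + -1 * g x); auto.
    apply functional_extensionality; intros x; ring. }
  assert (Sp : forall j t, spectrum N (3 * j + 1) (term N c w j t) /\
    spectrum N (3 * j + 1) (term_t N c w j t)) by (intros; now apply term_spectrum).
  assert (Bt : forall t t0 z, 0 <= t <= 1 -> 0 <= t0 <= 1 -> Rmin t0 t <= z <= Rmax t0 t ->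
    0 <= z <= 1).
  { intros t t0 z Ht Ht0. unfold Rmin, Rmax. destruct (Rle_dec t0 t); lra. }
  split; [exact HQ|]. split.
  - intros t Ht. split; intros j; (split; [apply Sp|]); intros x.
    + eapply Rle_trans; [apply (proj1 (B j t x Ht))|]. pose proof (majorant_ge_geom j). lra.
    + now apply B.
  - intros t t0 Ht Ht0. split; [|split].
    + intros j. split; [apply (Sub j (term N c w j t)); apply Sp|]. intros x.
      replace (Q * Rabs (t - t0) * majorant j) with (Q * majorant j * Rabs (t - t0)) by ring.
      apply (increment_bound (fun t => term N c w j t x) (fun t => term_t N c w j t x)).
      intros z Hz. split; [apply term_is_derive|]. now apply B, (Bt t t0).
    + intros j. split; [apply (Sub j (term_t N c w j t)); apply Sp|]. intros x.
      replace (Q * Rabs (t - t0) * majorant j) with (Q * majorant j * Rabs (t - t0)) by ring.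
      apply (increment_bound (fun t => term_t N c w j t x) (fun t => term_tt N c w j t x)).
      intros z Hz. split; [apply term_t_is_derive|]. now apply B, (Bt t t0).
    + intros Hne j. split.
      * apply (Sub j (fun x => (term N c w j t x - term N c w j t0 x) / (t - t0))); [|apply Sp].
        pose proof (spectrum_lin _ _ (/ (t - t0)) (- / (t - t0)) _ _
          (proj1 (Sp j t)) (proj1 (Sp j t0))) as H.
        replace (fun x => (term N c w j t x - term N c w j t0 x) / (t - t0)) with
          (fun x => / (t - t0) * term N c w j t x + - / (t - t0) * term N c w j t0 x); auto.
        apply functional_extensionality; intros x. unfold Rdiv. ring.
      * intros x.
        replace (Q * Rabs (t - t0) * majorant j) with (Q * majorant j * Rabs (t - t0)) by ring.
        apply (quotient_bound (fun t => term N c w j t x) (fun t => term_t N c w j t x)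
                 (fun t => term_tt N c w j t x)); auto.
        intros z Hz. split; [apply term_is_derive|]. split; [apply term_t_is_derive|].
        now apply B, (Bt t t0).
Qed.

Lemma family_ex_series (N : nat) (eta : R) (f : nat -> R -> R) (x : R) :
  family N eta f -> ex_series (fun j => f j x).
Proof.
  intros Hf. apply (ex_series_abs_le _ (fun j => eta * majorant j)); [intros j; apply Hf|].
  apply ex_series_majorant.
Qed.

Lemma PSeries_ev_derivable (N : nat) (t b K : R) (w : nat -> trigpoly) :
  (forall j, degree_le (3 * j + 1) (w j)) ->
  bounded_psum w K -> bounded_psum (sderiv w) K -> Rabs t <= 1 ->
  forall x, derivable_pt_lim (fun x => PSeries (fun j => ev (w j) (INR N * (x + b))) t) x
    (INR N * PSeries (fun j => ev (sderiv w j) (INR N * (x + b))) t).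
Proof.
  intros Hdeg Hw Hp Ht x.
  assert (D : forall l (a : R) x, is_derive (fun x => a * (ev l (INR N * (x + b)))) x
    (a * (INR N * ev (tderiv l) (INR N * (x + b))))).
  { intros l a z. auto_derive; [eexists; apply ev_derive|].
    rewrite (is_derive_unique _ _ _ (ev_derive _ _)). ring. }
  assert (T : forall l j y B, tnorm l <= B -> Rabs (t ^ j * ev l y) <= 1 * B).
  { intros l j y B HB. apply Rabs_mult_le; [now apply pow_le_1|].
    eapply Rle_trans; [apply ev_bound|exact HB]. }
  assert (HN : Rabs (INR N) <= INR N) by (rewrite Rabs_pos_eq; [lra|apply pos_INR]).
  pose proof (Series_derivable (fun j x => t ^ j * ev (w j) (INR N * (x + b)))
    (fun j x => t ^ j * (INR N * ev (sderiv w j) (INR N * (x + b))))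
    (fun j x => t ^ j * INR N * (INR N * ev (sderiv (sderiv w) j) (INR N * (x + b))))
    (fun j => K * (1 / 2) ^ j) (fun j => INR N * K * (1 / 2) ^ j)
    (fun j => INR N ^ 2 * 3 * K * majorant j)) as S.
  unfold PSeries. rewrite <- Series_scal_l.
  replace (fun x => Series (fun j => ev (w j) (INR N * (x + b)) * t ^ j)) with
    (fun x => Series (fun j => t ^ j * ev (w j) (INR N * (x + b))))
    by (apply functional_extensionality; intros z; apply Series_ext; intros j; ring).
  rewrite (Series_ext _ (fun j => t ^ j * (INR N * ev (sderiv w j) (INR N * (x + b)))))
    by (intros j; ring).
  apply S.
  - intros j z. apply D.
  - intros j z. apply (is_derive_ext (fun x => t ^ j * INR N * ev (sderiv w j) (INR N * (x + b)))).
    + intros y. apply Rmult_assoc.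
    + apply D.
  - intros j z. rewrite <- (Rmult_1_l (K * _)). apply T. now apply bounded_psum_tnorm.
  - intros j z.
    replace (t ^ j * (INR N * ev (sderiv w j) (INR N * (z + b)))) with
      (INR N * (t ^ j * ev (sderiv w j) (INR N * (z + b)))) by ring.
    replace (INR N * K * (1 / 2) ^ j) with (INR N * (1 * (K * (1 / 2) ^ j))) by ring.
    apply Rabs_mult_le; auto. apply T. now apply bounded_psum_tnorm.
  - intros j z.
    replace (t ^ j * INR N * (INR N * ev (sderiv (sderiv w) j) (INR N * (z + b)))) with
      (INR N * (INR N * (t ^ j * ev (sderiv (sderiv w) j) (INR N * (z + b))))) by ring.
    replace (INR N ^ 2 * 3 * K * majorant j) with (INR N * (INR N * (1 * (3 * K * majorant j)))) by ring.
    apply Rabs_mult_le; auto. apply Rabs_mult_le; auto. apply T.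
    eapply Rle_trans; [apply tnorm_tderiv, degree_le_tderiv, Hdeg|].
    pose proof (bounded_psum_tnorm _ _ j Hp) as B. pose proof (tnorm_nonneg (sderiv w j)).
    pose proof (pos_INR j).
    apply Rle_trans with (3 * (INR j + 1) ^ 2 * (K * (1 / 2) ^ j)).
    + apply Rmult_le_compat; auto; [apply pos_INR|].
      rewrite plus_INR, mult_INR. simpl. nra.
    + unfold majorant. right; ring.
  - apply ex_series_geom_half.
  - apply ex_series_geom_half.
  - apply ex_series_majorant.
Qed.

(** The part of [term_t] with [j * t ^ (j - 1)] sums to [w_t] and is given by the recursion. The
    part from the phase is [N * c * P], and [c = 1 + 14 * m] matches the linear transport. *)
Lemma wave_equation (N : nat) (e m t x : R) (w : nat -> trigpoly) :
  (0 < N)%nat -> 0 < e -> 0 <= m -> 0 <= t <= 1 ->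
  (forall j, degree_le (3 * j + 1) (w j)) ->
  bounded_psum w 3 -> bounded_psum (sderiv w) 3 -> (forall j, w (S j) = srhs N e m w j) ->
  let c := 1 + 14 * m in
  let y := INR N * (x + c * t) in
  let W := PSeries (fun j => ev (w j) y) t in
  let P := PSeries (fun j => ev (sderiv w j) y) t in
  e * Series (fun j => term_t N c w j t x) =
    e * INR N * P + 14 * (m + e * W) * (e * INR N * P) +
    PSeries (fun j => ev (tdxLm2 N (srem N e m w j)) y) t.
Proof.
  intros HN He Hm Ht Hdeg Hw Hp Hrec c y W P.
  assert (Ht1 : Rabs t <= 1) by (apply Rabs_le; lra).
  destruct (bounded_psum_srem N e m 3 w Hw Hp) as [K HK].
  assert (HG : bounded_psum (fun j => tdxLm2 N (srem N e m w j)) K).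
  { intros J. eapply Rle_trans; [|apply (HK J)]. apply sum_Rle. intros j _.
    apply Rmult_le_compat_r; [apply pow_le; lra|].
    eapply Rle_trans; [apply tnorm_tdxLm2, HN|].
    assert (HN1 : 1 <= INR N) by (apply (le_INR 1); lia).
    pose proof (tnorm_nonneg (srem N e m w j)).
    assert (/ INR N <= 1); [|nra]. rewrite <- Rinv_1. apply Rinv_le_contravar; lra. }
  set (G := PSeries (fun j => ev (tdxLm2 N (srem N e m w j)) y) t).
  destruct (term_families N c w) as [Q [_ [HF _]]]; auto; [unfold c; lra|].
  pose proof (family_ex_series _ _ _ x (proj2 (HF t Ht))) as E1.
  pose proof (bounded_psum_ex_pseries _ _ t y Hp Ht1) as EP.
  pose proof (bounded_psum_ex_pseries _ _ t y HG Ht1) as EG.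
  pose proof (bounded_psum_ex_pseries _ _ t y (bounded_psum_smul _ _ _ _ Hw Hp) Ht1) as EWP.
  set (A := fun j => INR j * t ^ pred j * ev (w j) y).
  assert (EkP : ex_series (fun j => INR N * c * (ev (sderiv w j) y * t ^ j)))
    by (apply (ex_series_scal (V := R_NormedModule)), EP).
  assert (EA : ex_series A).
  { apply (ex_series_ext (fun j => term_t N c w j t x - INR N * c * (ev (sderiv w j) y * t ^ j))).
    - intros j. unfold term_t, A. fold y.
      match goal with |- ?a = ?b => change (@eq R a b) end. ring.
    - apply (ex_series_minus (V := R_NormedModule) (fun j => term_t N c w j t x)); assumption. }
  assert (SA : Series A = 14 * e * INR N * (W * P) + / e * G).
  (* The term at [j = 0] vanishes. After the shift the factor [INR (S j)] cancels the division in
     [srhs], and the Cauchy product turns into [W * P]. *)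
  { rewrite Series_incr_1 by exact EA. unfold A at 1. simpl INR. rewrite !Rmult_0_l, Rplus_0_l.
    unfold W, P. rewrite <- (PSeries_smul _ _ _ _ t y Hw Hp Ht1).
    unfold G, PSeries. rewrite <- !Series_scal_l, <- Series_plus.
    - apply Series_ext. intros j. unfold A.
      rewrite Hrec. unfold srhs. rewrite ev_tscal, ev_app, !ev_tscal. simpl pred. field.
      split; [lra|]. apply not_0_INR. lia.
    - apply (ex_series_scal (V := R_NormedModule)), EWP.
    - apply (ex_series_scal (V := R_NormedModule)), EG. }
  rewrite (Series_ext _ (fun j => A j + INR N * c * (ev (sderiv w j) y * t ^ j)))
    by (intros j; unfold term_t, A; fold y; ring).
  rewrite Series_plus, SA, Series_scal_l by assumption.
  fold (PSeries (fun j => ev (sderiv w j) y) t). fold P.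
  unfold c. field. lra.
Qed.

(** The distance to the cosine must be small relative to the amplitude [N^(-s)], because the H^s
    norm multiplies the frequency [N] by [N^s]. The norm bound [C] is chosen before [N], [m] and
    [delta]. *)
Lemma wave_exists (s : R) : 3 / 2 < s -> exists C, 0 < C /\ forall N m delta,
  (0 < N)%nat -> 0 <= m <= 1 -> Rpower (INR N) (- s) * INR N <= delta -> / INR N <= delta ->
  5196 * delta <= 1 ->
  exists u : R -> R -> R,
    is_solution s 1 u /\
    (forall t, 0 <= t <= 1 -> Hnorm s (u t) <= C) /\
    (forall x, u 0 x = m + Rpower (INR N) (- s) * cos (INR N * x)) /\
    (forall t x, 0 <= t <= 1 ->
       Rabs (u t x - (m + Rpower (INR N) (- s) * cos (INR N * (x + (1 + 14 * m) * t)))) <=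
       Rpower (INR N) (- s) * (5196 * delta)).
Proof.
  intros Hs.
  assert (Hs0 : 0 <= s) by lra. assert (Hs1 : 0 <= s - 1) by lra.
  destruct (affine_Hnorm s Hs0) as [C0 [HC0 HB]].
  (* 1 bounds [m]; 3 bounds the coefficients of [w], and [e * N^s = 1]. *)
  exists (C0 * (1 + 3)). split; [lra|].
  intros N m delta HN Hm Hd1 Hd2 Hd.
  assert (HN1 : 1 <= INR N) by (apply (le_INR 1); lia).
  set (e := Rpower (INR N) (- s)) in *.
  assert (He : 0 < e <= 1).
  { split; [apply exp_pos|]. unfold e. rewrite <- (Rpower_O (INR N)) by lra.
    apply Rle_Rpower; lra. }
  destruct (formal_solution N e m delta HN He Hm Hd1 Hd2 Hd) as [w [W0 [WS [Wdeg Wsum]]]].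
  destruct (bounded_psum_wnorm w 3) as [Hw Hp].
  { intros J. eapply Rle_trans; [apply Wsum|lra]. }
  set (c := 1 + 14 * m).
  assert (Hc : 0 <= c) by (unfold c; lra).
  destruct (term_families N c w Hc Wdeg Hw) as [Q [HQ [HF HD]]].
  set (u := fun t x => m + e * Series (fun j => term N c w j t x)).
  set (v := fun t x => 0 + e * Series (fun j => term_t N c w j t x)).
  set (ux := fun t x => e * INR N * PSeries (fun j => ev (sderiv w j) (INR N * (x + c * t))) t).
  set (g := fun t x => PSeries (fun j => ev (tdxLm2 N (srem N e m w j)) (INR N * (x + c * t))) t).
  assert (Per : forall r t f a, 0 <= r -> 0 <= t <= 1 -> (exists eta, 0 <= eta /\ family N eta f) ->
    (forall j, periodic (f j)) -> inH r (fun x => a + e * Series (fun j => f j x))).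
  { intros r t f a Hr Ht [eta [Heta Hf]] Hper. split; [|split].
    - intros x. do 2 f_equal. apply Series_ext. intros j. apply Hper.
    - apply (continuity_plus (fun _ => a) (fun x => e * _)).
      + apply continuity_const; now intros x y.
      + apply (continuity_scal (fun x => Series _)), (family_continuity N eta), Hf.
    - destruct (affine_Hnorm r Hr) as [K [_ H]]. now apply (H N eta f a e). }
  exists u. split; [|split; [|split]].
  - exists ux, v, g. split; [|split; [|split]].
    + intros t Ht. assert (Ht1 : Rabs t <= 1) by (apply Rabs_le; lra).
      split; [|split; [|split; [|split]]].
      * apply (Per s t (fun j => term N c w j t)); auto.
        -- exists 3. split; [lra|]. now apply HF.
        -- intros j x. unfold term. f_equal. apply ev_periodic.
      * intros x.
        pose proof (PSeries_ev_derivable N t (c * t) 3 w Wdeg Hw Hp Ht1 x) as D.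
        pose proof (derivable_pt_lim_plus _ _ _ _ _ (derivable_pt_lim_const m x)
          (derivable_pt_lim_scal _ e _ _ D)) as D'.
        unfold ux. rewrite Rmult_assoc, <- (Rplus_0_l (e * _)). exact D'.
      * apply (Per (s - 1) t (fun j => term_t N c w j t)); auto.
        -- exists Q. split; [exact HQ|]. now apply HF.
        -- intros j x. unfold term_t. do 2 f_equal; apply ev_periodic.
      * destruct (bounded_psum_srem N e m 3 w Hw Hp) as [K HK].
        replace (fun x => Rnl (u t x) (ux t x)) with (fun x => Rnl m 0 +
          PSeries (fun j => ev (srem N e m w j) (INR N * (x + c * t))) t).
        -- now apply (is_dxLm2_series N _ K).
        -- apply functional_extensionality; intros x. symmetry.
           apply (PSeries_srem N e m 3 t (INR N * (x + c * t)) w Hw Hp Ht1).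
      * intros x. unfold v. rewrite Rplus_0_l.
        apply (wave_equation N e m t x w); auto; lra.
    + apply (Hcont_family s e m Q N); auto.
      * intros t x Ht. exact (family_ex_series _ _ _ x (proj1 (HF t Ht))).
      * intros t t0 Ht Ht0. now apply HD.
    + apply (Hcont_family (s - 1) e 0 Q N); auto.
      * intros t x Ht. exact (family_ex_series _ _ _ x (proj2 (HF t Ht))).
      * intros t t0 Ht Ht0. now apply HD.
    + apply (Hderiv_family (s - 1) e m Q N); auto.
      * intros t x Ht. exact (family_ex_series _ _ _ x (proj1 (HF t Ht))).
      * intros t x Ht. exact (family_ex_series _ _ _ x (proj2 (HF t Ht))).
      * intros t t0 Ht Ht0. now apply HD.
  - intros t Ht.
    destruct (HB N 3 (fun j => term N c w j t) m e HN) as [_ B]; [lra|now apply HF|].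
    eapply Rle_trans; [exact B|]. apply Rmult_le_compat_l; [lra|].
    rewrite !Rabs_pos_eq by lra.
    replace (e * Rpower (INR N) s) with 1; [lra|].
    unfold e. rewrite <- Rpower_plus, Rplus_opp_l. symmetry. apply Rpower_O. lra.
  - intros x. unfold u. do 2 f_equal.
    rewrite Series_incr_1 by exact (family_ex_series _ _ _ x (proj1 (HF 0 ltac:(lra)))).
    rewrite Series_zero by (intros j; unfold term; simpl; ring).
    unfold term. rewrite W0. simpl. rewrite Rmult_0_r, Rplus_0_r.
    rewrite !Rmult_1_l, !Rplus_0_r, Rmult_1_r. reflexivity.
  - intros t x Ht. unfold u.
    pose proof (family_ex_series _ _ _ x (proj1 (HF t Ht))) as E.
    rewrite Series_incr_1 by exact E.
    set (rest := Series (fun k => term N c w (S k) t x)).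
    assert (T0 : term N c w 0 t x = cos (INR N * (x + (1 + 14 * m) * t))).
    { unfold term. rewrite W0. simpl. rewrite !Rmult_1_l, !Rplus_0_r, Rmult_1_r. reflexivity. }
    rewrite T0. set (X := cos _).
    replace (m + e * (X + rest) - (m + e * X)) with (e * rest) by ring.
    rewrite Rabs_mult, (Rabs_pos_eq e) by lra. apply Rmult_le_compat_l; [lra|].
    (* The sum of the norms of the [w j] with [j >= 1] is at most [psum (wnorm w) J - 2]. *)
    destruct (infinite_sum_bounded (fun k => wnorm w (S k)) (5196 * delta)) as [l [Hl [_ Hl2]]].
    + intros k. unfold wnorm. pose proof (tnorm_nonneg (w (S k))).
      pose proof (tnorm_nonneg (sderiv w (S k))). lra.
    + intros J. specialize (Wsum (S J)). unfold psum in Wsum.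
      rewrite decomp_sum in Wsum by lia. simpl pred in Wsum.
      assert (A0 : wnorm w 0 = 2).
      { unfold wnorm, sderiv. rewrite W0. simpl. rewrite Rmult_1_r, Rabs_R1. ring. }
      rewrite A0 in Wsum. simpl (2 ^ 0) in Wsum.
      assert (sum_f_R0 (fun k => wnorm w (S k)) J <= sum_f_R0 (fun i => wnorm w (S i) * 2 ^ S i) J).
      { apply sum_Rle. intros i _.
        assert (0 <= wnorm w (S i)).
        { unfold wnorm. pose proof (tnorm_nonneg (w (S i))).
          pose proof (tnorm_nonneg (sderiv w (S i))). lra. }
        assert (1 <= 2 ^ S i) by (apply pow_R1_Rle; lra). nra. }
      lra.
    + apply is_series_Reals in Hl. rewrite <- (is_series_unique _ _ Hl) in Hl2.
      eapply Rle_trans; [|exact Hl2].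
      apply Series_abs_le; [|now exists l]. intros k. unfold term.
      apply Rle_trans with (tnorm (w (S k)) * 1).
      * apply Rabs_mult_le; [apply ev_bound|]. apply pow_le_1, Rabs_le; lra.
      * unfold wnorm. pose proof (tnorm_nonneg (sderiv w (S k))). lra.
Qed.

(** * Separation of the phases *)

Lemma fcoef_phase (f : R -> R) (k : Z) (th : R) : continuity f ->
  fcoef f k th = cos th * fcoef f k 0 - sin th * fcoef f k (- (PI / 2)).
Proof.
  intros Hf. apply is_RInt_fcoef_eq.
  apply (is_RInt_ext (fun x => minus (scal (cos th) (f x * cos (IZR k * x + 0)))
    (scal (sin th) (f x * cos (IZR k * x + - (PI / 2)))))).
  - intros x _. unfold minus, plus, opp, scal; simpl; unfold Hierarchy.mult; simpl.
    rewrite Rplus_0_r, !cos_plus, cos_neg, sin_neg, cos_PI2, sin_PI2. ring.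
  - apply (is_RInt_minus (V := R_NormedModule));
      apply (is_RInt_scal (V := R_NormedModule)); apply is_RInt_fcoef, Hf.
Qed.

(** The square of the norm is at least its term at frequency [N], whose weight is at least
    [N^(2 s)]; [sqrt (2 * PI)] is the normalization of [phi_k]. A coefficient with phase [th] is the
    projection of the complex one on a direction, hence not larger. *)
Lemma Hnorm_ge_fcoef (s th l : R) (f : R -> R) (N : nat) :
  0 <= s -> (0 < N)%nat -> continuity f -> infinite_sum (Hterm s f) l ->
  Rpower (INR N) s * Rabs (fcoef f (Z.of_nat N) th) <= sqrt (2 * PI) * Hnorm s f.
Proof.
  intros Hs HN Hf Hl. pose proof PI_RGT_0 as HPI.
  assert (HN1 : 1 <= INR N) by (apply (le_INR 1); lia).
  unfold Hnorm. rewrite (Hsq_eq _ _ _ Hl).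
  assert (Hpart : sum_f_R0 (Hterm s f) N <= l).
  { apply (growing_ineq (sum_f_R0 (Hterm s f))); [|exact Hl].
    intros n. simpl. pose proof (Hterm_nonneg s f (S n)). lra. }
  assert (HT : Hterm s f N <= l).
  { eapply Rle_trans; [|exact Hpart]. destruct N as [|n]; [lia|]. simpl sum_f_R0.
    assert (0 <= sum_f_R0 (Hterm s f) n) by (apply cond_pos_sum, Hterm_nonneg). lra. }
  set (n := Rpower (INR N) s). assert (Hn : 0 < n) by apply exp_pos.
  assert (HW : n ^ 2 <= weight s (Z.of_nat N)).
  { unfold weight. rewrite <- INR_IZR_INZ.
    replace (n ^ 2) with (Rpower (INR N * INR N) s)
      by (rewrite <- Rpower_mult_distr by lra; unfold n; ring).
    apply Rle_Rpower_l; [exact Hs|]. nra. }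
  assert (HF : n ^ 2 * fc2 f (Z.of_nat N) <= l).
  { eapply Rle_trans; [|exact HT]. unfold Hterm.
    pose proof (fc2_nonneg f (Z.of_nat N)).
    assert (0 <= weight s (- Z.of_nat (S N)) * fc2 f (- Z.of_nat (S N))).
    { apply Rmult_le_pos; [left; apply weight_pos|apply fc2_nonneg]. }
    assert (n ^ 2 * fc2 f (Z.of_nat N) <= weight s (Z.of_nat N) * fc2 f (Z.of_nat N)).
    { now apply Rmult_le_compat_r. }
    lra. }
  assert (HC : fcoef f (Z.of_nat N) th ^ 2 <= 2 * PI * fc2 f (Z.of_nat N)).
  { unfold fc2. rewrite Ck_fcoef, Sk_fcoef, (fcoef_phase f _ th Hf).
    set (a := fcoef f _ 0). set (b := fcoef f _ (- (PI / 2))).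
    replace (2 * PI * ((a ^ 2 + b ^ 2) / (2 * PI))) with (a ^ 2 + b ^ 2) by (field; lra).
    (* With [sin^2 + cos^2 = 1], the difference of the two sides is the square of
       [sin th * a + cos th * b]. *)
    pose proof (sin2_cos2 th) as E. unfold Rsqr in E.
    pose proof (pow2_ge_0 (sin th * a + cos th * b)).
    replace (a ^ 2 + b ^ 2) with ((a ^ 2 + b ^ 2) * (sin th * sin th + cos th * cos th))
      by (rewrite E; ring). nra. }
  assert (Hl0 : 0 <= l).
  { eapply Rle_trans; [apply (Hterm_nonneg s f N)|exact HT]. }
  rewrite <- sqrt_mult by lra.
  rewrite <- (sqrt_pow2 (n * Rabs (fcoef f (Z.of_nat N) th)))
    by (apply Rmult_le_pos; [lra|apply Rabs_pos]).
  apply sqrt_le_1; [apply pow2_ge_0|nra|].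
  rewrite Rpow_mult_distr, pow2_abs.
  apply Rle_trans with (n ^ 2 * (2 * PI * fc2 f (Z.of_nat N))).
  - apply Rmult_le_compat_l; [apply pow2_ge_0|exact HC].
  - nra.
Qed.

(** With [A = N * (x + t) + t] the difference is [cos (A + t) - cos (A - t) = 2 * sin t * cos (A +
    PI / 2)]. The phase [th] is that of this wave, so its coefficient at [N] is [2 * PI * sin t];
    the constant [m] has none there, and the error contributes at most [2 * PI * B]. *)
Lemma phase_shift_fcoef (N : nat) (m e t B : R) (f : R -> R) :
  (0 < N)%nat -> continuity f ->
  (forall x, Rabs (f x - (m + e * (cos (INR N * (x + t) + 2 * t) - cos (INR N * (x + t))))) <= B) ->
  exists th, 2 * PI * (Rabs e * Rabs (sin t) - B) <= Rabs (fcoef f (Z.of_nat N) th).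
Proof.
  intros HN Hf HB. pose proof PI_RGT_0 as HPI.
  set (th := INR N * t + t + PI / 2). exists th.
  set (h := fun x => cos (IZR (Z.of_nat N) * x + th)).
  assert (Ch : continuity h) by apply continuity_cos_affine.
  set (p := fun x => 1 * m + 2 * e * sin t * h x).
  assert (Cm : continuity (fun _ => m)) by (apply continuity_const; now intros x y).
  assert (Cp : continuity p).
  { apply (continuity_plus (fun _ => 1 * m) (fun x => 2 * e * sin t * h x)).
    - apply continuity_const; now intros x y.
    - now apply continuity_scal. }
  assert (Ep : forall x,
    m + e * (cos (INR N * (x + t) + 2 * t) - cos (INR N * (x + t))) = p x).
  { intros x. unfold p, h, th. rewrite <- INR_IZR_INZ.
    replace (INR N * x + (INR N * t + t + PI / 2)) with ((INR N * (x + t) + t) + PI / 2) by ring.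
    replace (INR N * (x + t) + 2 * t) with ((INR N * (x + t) + t) + t) by ring.
    replace (cos (INR N * (x + t))) with (cos ((INR N * (x + t) + t) - t)) by (f_equal; ring).
    set (A := INR N * (x + t) + t).
    rewrite (cos_plus A (PI / 2)), cos_PI2, sin_PI2, cos_plus, cos_minus. ring. }
  assert (Fp : fcoef p (Z.of_nat N) th = 2 * PI * (e * sin t)).
  { unfold p. rewrite (fcoef_lin 1 _ (fun _ => m) h) by assumption.
    rewrite (proj2 (spectrum_const 1 m)) by (intros [k' [E1 E2]]; lia).
    unfold h. rewrite fcoef_cos.
    destruct (Z.eq_dec _ 0) as [E|_]; [lia|]. destruct (Z.eq_dec _ 0) as [_|E]; [|lia].
    rewrite Rminus_diag, cos_0. ring. }
  assert (D : fcoef f (Z.of_nat N) th =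
    2 * PI * (e * sin t) + fcoef (fun x => 1 * f x + -1 * p x) (Z.of_nat N) th).
  { rewrite fcoef_lin, Fp by assumption. ring. }
  assert (R : Rabs (fcoef (fun x => 1 * f x + -1 * p x) (Z.of_nat N) th) <= 2 * PI * B).
  { apply fcoef_bound.
    - apply (continuity_plus (fun x => 1 * f x) (fun x => -1 * p x)); now apply continuity_scal.
    - intros x. specialize (HB x). rewrite Ep in HB.
      replace (1 * f x + -1 * p x) with (f x - p x) by ring. exact HB. }
  rewrite D. set (r := fcoef (fun x => _) _ _) in *.
  pose proof (Rabs_triang (2 * PI * (e * sin t) + r) (- r)) as T.
  replace (2 * PI * (e * sin t) + r + - r) with (2 * PI * (e * sin t)) in T by ring.
  rewrite Rabs_Ropp, !Rabs_mult, (Rabs_pos_eq 2), (Rabs_pos_eq PI) in T by lra.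
  lra.
Qed.

(** As [s > 3/2], both quantities are at most [N^(-1/2)], which is below [eta] once
    [N > eta^(-2)]. *)
Lemma small_parameters (s eta : R) : 3 / 2 < s -> 0 < eta ->
  exists N0, forall N, (N0 <= N)%nat -> (0 < N)%nat /\
    Rpower (INR N) (- s) * INR N <= eta /\ / INR N <= eta.
Proof.
  intros Hs Heta.
  destruct (archimed (/ eta ^ 2)) as [HA _].
  assert (P : 0 < / eta ^ 2) by (apply Rinv_0_lt_compat, pow_lt, Heta).
  exists (S (Z.to_nat (up (/ eta ^ 2)))). intros N HN.
  assert (HN' : / eta ^ 2 < INR N).
  { eapply Rlt_le_trans; [exact HA|].
    rewrite <- (Z2Nat.id (up (/ eta ^ 2))) by (apply le_IZR; lra).
    rewrite <- INR_IZR_INZ. apply le_INR. lia. }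
  assert (HN1 : 1 <= INR N) by (apply (le_INR 1); lia).
  assert (HR : / sqrt (INR N) <= eta).
  { rewrite <- (Rinv_inv eta). apply Rinv_le_contravar; [now apply Rinv_0_lt_compat|].
    rewrite <- (sqrt_pow2 (/ eta)) by (left; now apply Rinv_0_lt_compat).
    apply sqrt_le_1_alt. rewrite pow_inv. lra. }
  assert (Hsq : 1 <= sqrt (INR N)) by (rewrite <- sqrt_1; apply sqrt_le_1_alt; lra).
  split; [lia|]. split.
  - rewrite <- (Rpower_1 (INR N)) at 2 by lra. rewrite <- Rpower_plus.
    apply Rle_trans with (Rpower (INR N) (- / 2)); [apply Rle_Rpower; lra|].
    rewrite Rpower_Ropp, Rpower_sqrt by lra. exact HR.
  - eapply Rle_trans; [|exact HR]. apply Rinv_le_contravar; [lra|].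
    rewrite <- (sqrt_sqrt (INR N)) at 2 by lra. nra.
Qed.

(** * The two sequences and the lower bound for their distance *)

Theorem theorem1p1 :
  forall s : R, 3 / 2 < s ->
  exists Tu C : R, 0 < Tu /\ 0 < C /\
  exists u ut : nat -> R -> R -> R,
    (forall n, is_solution s Tu (u n) /\ is_solution s Tu (ut n)) /\
    (forall n t, 0 <= t <= Tu -> Hnorm s (u n t) + Hnorm s (ut n t) <= C) /\
    Un_cv (fun n => Hnorm s (fun x => u n 0 x - ut n 0 x)) 0 /\
    (forall t, 0 < t <= Tu ->
       (* liminf_n ||u_n(t) - ut_n(t)||_{H^s} >= C^{-1} |sin t| *)
       forall eps, 0 < eps -> exists N : nat, forall n, (N <= n)%nat ->
         / C * Rabs (sin t) - eps <= Hnorm s (fun x => u n t x - ut n t x)).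
Proof.
  intros s Hs. assert (Hs0 : 0 <= s) by lra.
  destruct (wave_exists s Hs) as [C [HC Hex]].
  destruct (const_Hsum s Hs0) as [K [HK Hconst]].
  set (del := fun N => Rmax (Rpower (INR N) (- s) * INR N) (/ INR N)).
  assert (Hdel : forall eta, 0 < eta -> exists N0, forall N, (N0 <= N)%nat ->
    (0 < N)%nat /\ del N <= eta).
  { intros eta Heta. destruct (small_parameters s eta Hs Heta) as [N0 H0]. exists N0.
    intros N HN. destruct (H0 N HN) as [A [B D]]. split; [exact A|]. now apply Rmax_lub. }
  (* The smallness required by the construction holds from [N0] on, so the [n]-th pair of waves gets
     the frequency [n + N0]. *)
  destruct (Hdel (/ 5196)) as [N0 HN0]; [lra|].
  assert (Hu : forall m n, 0 <= m <= 1 -> exists u : R -> R -> R,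
    is_solution s 1 u /\
    (forall t, 0 <= t <= 1 -> Hnorm s (u t) <= C) /\
    (forall x, u 0 x = m + Rpower (INR (n + N0)) (- s) * cos (INR (n + N0) * x)) /\
    (forall t x, 0 <= t <= 1 -> Rabs (u t x - (m + Rpower (INR (n + N0)) (- s) *
       cos (INR (n + N0) * (x + (1 + 14 * m) * t)))) <=
       Rpower (INR (n + N0)) (- s) * (5196 * del (n + N0)%nat))).
  { intros m n Hm. destruct (HN0 (n + N0)%nat) as [A B]; [lia|].
    apply Hex; auto; [apply Rmax_l|apply Rmax_r|lra]. }
  assert (Hpos : forall n, 1 <= INR (n + N0)).
  { intros n. apply (le_INR 1). destruct (HN0 (n + N0)%nat); lia. }
  (* The speeds [1 + 14 * m] and [1] produce the phase difference [14 * m * N * t = 2 * t]. *)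
  set (m := fun n => / (7 * INR (n + N0))).
  assert (Hm : forall n, 0 <= m n <= 1).
  { intros n. specialize (Hpos n). unfold m. split.
    - left. apply Rinv_0_lt_compat. lra.
    - rewrite <- Rinv_1. apply Rinv_le_contravar; lra. }
  set (U := fun n => constructive_indefinite_description _ (Hu (m n) n (Hm n))).
  assert (H01 : 0 <= 0 <= 1) by lra.
  set (V := fun n => constructive_indefinite_description _ (Hu 0 n H01)).
  (* [2 * C] bounds the two norms together; the additional 1 ensures that the inverse is at most 1,
     the constant obtained in the lower bound. *)
  exists 1, (2 * C + 1). split; [lra|]. split; [lra|].
  exists (fun n => proj1_sig (U n)), (fun n => proj1_sig (V n)).
  split; [|split; [|split]].
  - intros n. split; [apply (proj2_sig (U n))|apply (proj2_sig (V n))].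
  - intros n t Ht. destruct (proj2_sig (U n)) as [_ [A _]]. destruct (proj2_sig (V n)) as [_ [B _]].
    specialize (A t Ht). specialize (B t Ht). lra.
  - intros eps Heps.
    assert (HsK : 0 < sqrt K) by now apply sqrt_lt_R0.
    destruct (Hdel (eps / sqrt K)) as [N1 HN1]; [now apply Rdiv_lt_0_compat|].
    exists N1. intros n Hn.
    destruct (proj2_sig (U n)) as [_ [_ [A _]]]. destruct (proj2_sig (V n)) as [_ [_ [B _]]].
    (* Both waves start with the same cosine, so the initial data differ by a constant. *)
    replace (fun x => proj1_sig (U n) 0 x - proj1_sig (V n) 0 x) with (fun _ : R => m n)
      by (apply functional_extensionality; intros x; rewrite A, B; ring).
    destruct (Hconst (m n)) as [l [Hl Hl2]]. unfold Hnorm. rewrite (Hsq_eq _ _ _ Hl).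
    unfold Rdist. rewrite Rminus_0_r, Rabs_pos_eq by apply sqrt_pos.
    apply Rle_lt_trans with (sqrt K * m n).
    + rewrite <- (sqrt_pow2 (m n)) by apply Hm. rewrite <- sqrt_mult_alt by lra.
      apply sqrt_le_1_alt. lra.
    + destruct (HN1 (n + N0)%nat) as [_ D]; [lia|].
      assert (M : m n < / INR (n + N0)).
      { unfold m. specialize (Hpos n). apply Rinv_lt_contravar; [nra|lra]. }
      pose proof (Rmax_r (Rpower (INR (n + N0)) (- s) * INR (n + N0)) (/ INR (n + N0))) as E.
      fold (del (n + N0)%nat) in E.
      rewrite Rmult_comm. apply Rlt_div_r; lra.
  - intros t Ht eps Heps.
    (* [31176 = 3 * 10392]: here [10392 = 2 * 5196] collects the errors of the two waves, and 3
       bounds [sqrt (2 * PI)]. *)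
    destruct (Hdel (eps / 31176)) as [N1 HN1]; [lra|].
    exists N1. intros n Hn. destruct (HN1 (n + N0)%nat) as [HNpos HD]; [lia|].
    specialize (Hpos n).
    assert (Ht1 : 0 <= t <= 1) by lra.
    destruct (proj2_sig (U n)) as [[ux [v [g [SU _]]]] [_ [_ AU]]].
    destruct (proj2_sig (V n)) as [[ux' [v' [g' [SV _]]]] [_ [_ AV]]].
    destruct (SU t Ht1) as [[_ [CU [lU LU]]] _]. destruct (SV t Ht1) as [[_ [CV [lV LV]]] _].
    set (u := proj1_sig (U n)) in *. set (w := proj1_sig (V n)) in *.
    set (N := (n + N0)%nat) in *. set (e := Rpower (INR N) (- s)) in *.
    assert (He : 0 < e) by apply exp_pos.
    set (f := fun x => u t x - w t x).
    assert (Ef : f = fun x => 1 * u t x + -1 * w t x)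
      by (apply functional_extensionality; intros x; unfold f; ring).
    assert (Cf : continuity f) by (apply (continuity_minus (u t) (w t)); assumption).
    destruct (Hsum_lin s 1 (-1) lU lV (u t) (w t) CU CV LU LV) as [l [Hl _]].
    rewrite <- Ef in Hl.
    destruct (phase_shift_fcoef N (m n) e t (e * (10392 * del N)) f HNpos Cf) as [th Hth].
    { intros x. specialize (AU t x Ht1). specialize (AV t x Ht1).
      replace (INR N * (x + (1 + 14 * m n) * t)) with (INR N * (x + t) + 2 * t) in AU
        by (unfold m; fold N; field; lra).
      replace (INR N * (x + (1 + 14 * 0) * t)) with (INR N * (x + t)) in AV by ring.
      set (c1 := cos (INR N * (x + t) + 2 * t)) in *. set (c2 := cos (INR N * (x + t))) in *.
      replace (f x - (m n + e * (c1 - c2))) with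
        ((u t x - (m n + e * c1)) + - (w t x - (0 + e * c2))) by (unfold f; ring).
      eapply Rle_trans; [apply Rabs_triang|]. rewrite Rabs_Ropp. lra. }
    pose proof (Hnorm_ge_fcoef s th l f N Hs0 HNpos Cf Hl) as HH.
    fold f. set (H := Hnorm s f) in *.
    assert (Ene : Rpower (INR N) s * e = 1).
    { unfold e. rewrite <- Rpower_plus, Rplus_opp_r. apply Rpower_O. lra. }
    set (q := sqrt (2 * PI)) in *.
    pose proof PI_RGT_0 as HPI. pose proof PI_4 as HPI4. pose proof PI2_1 as HPI2.
    assert (Hq2 : q * q = 2 * PI) by (apply sqrt_sqrt; lra).
    assert (Hq0 : 0 <= q) by apply sqrt_pos.
    assert (Hq1 : 1 <= q) by nra. assert (Hq3 : q <= 3) by nra.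
    (* Of the factor [2 * PI = q * q] one [q] cancels against the normalization. The other is
       bounded below by 1 in front of [|sin t|] and above by 3 in front of the error. *)
    assert (Main : q * (q * (Rabs (sin t) - 10392 * del N)) <= q * H).
    { eapply Rle_trans; [|exact HH].
      apply Rle_trans with (Rpower (INR N) s * (2 * PI * (Rabs e * Rabs (sin t) - e * (10392 * del N)))).
      - rewrite (Rabs_pos_eq e) by lra.
        replace (Rpower (INR N) s * (2 * PI * (e * Rabs (sin t) - e * (10392 * del N)))) with
          (Rpower (INR N) s * e * (2 * PI * (Rabs (sin t) - 10392 * del N))) by ring.
        rewrite Ene, <- Hq2. right; ring.
      - apply Rmult_le_compat_l; [left; apply exp_pos|exact Hth]. }
    apply Rmult_le_reg_l in Main; [|lra].
    pose proof (Rabs_pos (sin t)) as Hsin.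
    assert (Hdel0 : 0 <= del N).
    { unfold del. eapply Rle_trans; [|apply Rmax_r]. left. apply Rinv_0_lt_compat. lra. }
    assert (/ (2 * C + 1) * Rabs (sin t) <= Rabs (sin t)).
    { rewrite <- (Rmult_1_l (Rabs (sin t))) at 2. apply Rmult_le_compat_r; auto.
      rewrite <- Rinv_1. apply Rinv_le_contravar; lra. }
    assert (q * (10392 * del N) <= eps) by nra.
    nra.
Qed.
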